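(* Let $A=\{f_1,\cdots,f_s\}\subset H^2_{\mathbb C^n}$, let $F:=[f_1,\cdots,f_s]$ be the $n\times s$ matrix function with these columns, and let $\bar g_i\in\overline{H^2_{\mathbb C^s}}$ be the $i$-th column of $F^*$ ($i=1,\dots,n$). Set $\alpha:=\mathrm{ind}_{\mathcal N}\{\bar g_1,\cdots,\bar g_n\}$. Then $E^*_A=H^2_{\mathbb C^n}\ominus\Theta H^2_{\mathbb C^{n-\alpha}}$ for some $n\times(n-\alpha)$ matrix inner function $\Theta$.
   Context: $S$ is the shift $Sf=zf$ on $H^2_{\mathbb C^n}$ and $S^*$ its adjoint (backward shift). $E^*_A$ is the closed linear span of $\{S^{*k}f_i: k\ge0,\ 1\le i\le s\}$. $F^*(\zeta)=F(\zeta)^*$ pointwise. A matrix function $\Theta\in H^\infty_{M_{n\times k}}$ is inner if $\Theta^*\Theta=I$ a.e. on $\mathbb T$; by convention, for $k=0$, $\Theta H^2_{\mathbb C^0}=\{0\}$. The Nevanlinna class $\mathcal N$ is the set of functions on $\mathbb T$ of the form $f/g$ with $f,g\in H^\infty$, $g\neq0$; $\mathcal N_{\mathbb C^s}$ denotes vectors with entries in $\mathcal N$. Vectors $\varphi_1,\dots,\varphi_r\in L^2_{\mathbb C^s}$ are independent modulo Nevanlinna class if $a_i\in\mathcal N$ and $\sum a_i\varphi_i\in\mathcal N_{\mathbb C^s}$ imply all $a_i=0$; $\mathrm{ind}_{\mathcal N}$ of a finite list is the largest size of an independent sub-list ($0$ if none). *)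

(* Defs.v *)
From HB Require Import structures.
From mathcomp Require Import all_boot all_order all_algebra.
From mathcomp Require Import all_classical all_reals all_analysis.
From mathcomp Require Import complex.
Set Implicit Arguments. Unset Strict Implicit. Unset Printing Implicit Defensive.
Import Order.TTheory GRing.Theory Num.Theory.
Import numFieldNormedType.Exports.
Local Open Scope classical_set_scope.
Local Open Scope ring_scope.

(* The unit circle T is parametrised by t in [0,1] via zeta = exp(2 pi i t);
   normalised Lebesgue measure on T = Lebesgue measure on [0,1]. *)
Section Hardy.
Variable R : realType.
Local Notation C := R[i].
Local Notation mu := (@lebesgue_measure R).

Definition Tset : set R := `[0%R, 1%R]%classic.

Definition cfun := R -> C.
Definition vfun (n : nat) := 'I_n -> R -> C.

Definition cnorm2 (z : C) : R := complex.Re z ^+ 2 + complex.Im z ^+ 2.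

Definition cint (f : cfun) : C :=
  Complex (\int[mu]_(x in Tset) complex.Re (f x)) (\int[mu]_(x in Tset) complex.Im (f x)).

Definition zpow (k : int) (t : R) : C :=
  Complex (cos (2 * pi * k%:~R * t)) (sin (2 * pi * k%:~R * t)).

Definition cmeasurable (f : cfun) :=
  measurable_fun Tset (fun x => complex.Re (f x)) /\ measurable_fun Tset (fun x => complex.Im (f x)).

Definition L2c (f : cfun) :=
  cmeasurable f /\ (\int[mu]_(x in Tset) (cnorm2 (f x))%:E < +oo)%E.

(* H^2: L^2 functions whose negative Fourier coefficients vanish,
   hat f(-k-1) = int f(t) zeta^{k+1} dt = 0 *)
Definition H2c (f : cfun) :=
  L2c f /\ forall k : nat, cint (fun x => f x * zpow (k.+1)%:Z x) = 0.

Definition H2v n (f : vfun n) := forall i, H2c (f i).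

Definition vnorm2 n (f : vfun n) : \bar R :=
  (\int[mu]_(x in Tset) (\sum_(i < n) cnorm2 (f i x))%:E)%E.

Definition Hinf (f : cfun) :=
  H2c f /\ exists M : R, {ae mu, forall x, Tset x -> cnorm2 (f x) <= M}.

Definition mxfun n k := 'I_n -> 'I_k -> R -> C.

Definition inner n k (Th : mxfun n k) :=
  (forall i j, Hinf (Th i j)) /\
  {ae mu, forall x, Tset x -> forall j j' : 'I_k,
      \sum_(i < n) conjc (Th i j x) * Th i j' x = (j == j')%:R}.

Definition mapply n k (Th : mxfun n k) (h : vfun k) : vfun n :=
  fun i x => \sum_(j < k) Th i j x * h j x.

(* backward shift S^* f = conj(zeta) (f - f(0)), with f(0) = hat f(0) *)
Definition bshift n (f : vfun n) : vfun n :=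
  fun i x => zpow (-1) x * (f i x - cint (f i)).

Definition comb n s (f : 'I_s -> vfun n) (N : nat) (c : nat -> 'I_s -> C) : vfun n :=
  fun i x => \sum_(k < N) \sum_(j < s) c k j * iter k (@bshift n) (f j) i x.

Definition Estar n s (f : 'I_s -> vfun n) (g : vfun n) :=
  H2v g /\ forall eps : R, 0 < eps ->
    exists (N : nat) (c : nat -> 'I_s -> C),
      (vnorm2 (fun i x => (g i x - comb f N c i x)%R) < eps%:E)%E.

Definition orthoCompl n k (Th : mxfun n k) (g : vfun n) :=
  H2v g /\ forall h : vfun k, H2v h ->
    cint (fun x => \sum_(i < n) g i x * conjc (mapply Th h i x)) = 0.

Definition Nev (phi : cfun) :=
  exists a b : cfun, [/\ Hinf a, Hinf b,
     ~ {ae mu, forall x, Tset x -> b x = 0} &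
     {ae mu, forall x, Tset x -> phi x * b x = a x}].

Definition indepN r s (phi : 'I_r -> vfun s) (I : {set 'I_r}) :=
  forall a : 'I_r -> cfun,
    (forall i, i \in I -> Nev (a i)) ->
    (forall j : 'I_s, Nev (fun x => \sum_(i in I) a i x * phi i j x)) ->
    forall i, i \in I -> {ae mu, forall x, Tset x -> a i x = 0}.

Definition indN r s (phi : 'I_r -> vfun s) : nat :=
  \max_(I : {set 'I_r} | `[< indepN phi I >]) #|I|.

(* columns of F^* : gbar_i = (conj (f_j)_i)_j, for F = [f_1 .. f_s] *)
Definition gbar n s (f : 'I_s -> vfun n) : 'I_n -> vfun s :=
  fun i j x => conjc (f j i x).

End Hardy.

(* Main.v *)
Require Import Defs.
From HB Require Import structures.
From mathcomp Require Import all_boot all_order all_algebra.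
From mathcomp Require Import all_classical all_reals all_analysis.
From mathcomp Require Import perm measurable_realfun complex ring lra zify.
Set Implicit Arguments. Unset Strict Implicit. Unset Printing Implicit Defensive.
Import Order.TTheory GRing.Theory Num.Theory.
Import numFieldNormedType.Exports.
Local Open Scope classical_set_scope.
Local Open Scope ring_scope.

(** Let [M] be the space of [h] in [H^2] orthogonal to the backward shift orbits of the [f_j],
    i.e. such that [F^* h] has no Fourier coefficient of nonpositive index. By the Beurling-Lax
    theorem, [M = Theta H^2] for an inner [Theta] with [k] columns: an orthonormal basis of
    [M (-) zM] is pointwise orthonormal, because the pointwise inner product of two wandering
    vectors has only one nonzero Fourier coefficient. Hence [E^*_A = H^2 (-) Theta H^2], and the
    point is that [k = n - alpha].

    The relations [sum_i a_i gbar_i in N] with [a_i in N] are, after clearing denominators, the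
    elements of [M], so they form an [N]-vector space of dimension [k] spanned by the columns of
    [Theta]. A set [I] of indices is independent modulo [N] iff no nonzero relation is supported
    in [I]; thus [#|I| <= n - k], with equality for the complement of the rows of a nonzero
    [k]-minor of [Theta].

    The two facts on scalar functions that are needed, [H^2 <= N] and the a.e. nonvanishing of a
    nonzero [H^2] function, are themselves instances of the Beurling-Lax theorem, for the
    subspaces [{(a, a f)}] of [H^2_{C^2}] and [{h | h = 0 on the zero set of u}] of [H^2]. *)

(** * Square-integrable functions on the circle *)

Arguments cint : simpl never.
Arguments zpow : simpl never.
Arguments cnorm2 : simpl never.

Section Base.
Variable R : realType.
Local Notation C := R[i].
Local Notation mu := (@lebesgue_measure R).
Local Notation Re := complex.Re.
Local Notation Im := complex.Im.
Implicit Types (f g h u : cfun R) (P Q : R -> Prop) (z w : C).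

(** Functions here are functions on [0,1] compared almost everywhere, and subspaces are predicates
    on them. Completeness of L^2 and orthogonal projection are therefore proved for predicates
    stable under linear combinations, with no quotient taken. A subspace that has to be closed is
    described as the set orthogonal to a family of test functions, a condition that survives limits
    by Cauchy-Schwarz; if the family is stable under multiplication by 1/z, the subspace is
    z-invariant. Hence the Beurling-Lax theorem is stated for annihilators, and graphs and zero sets
    fit the same pattern.

    The obstacle is that a pointwise inner product of two L^2 vectors, or a product of two H^2
    functions, is only integrable. For the former, uniqueness of Fourier coefficients is proved in
    L^1, by approximating indicators of arcs boundedly by trigonometric polynomials. For the latter,
    one factor is replaced by analytic monomials through a bi-annihilator.

    The vectors z^(-l) f_j and their analytic counterparts, the iterated backward shifts of f_j,
    have the same inner products with H^2; only the former are stable under multiplication by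
    1/z. *)

Lemma cReM z w : Re (z * w) = Re z * Re w - Im z * Im w.
Proof. by case: z w => a b [c d]. Qed.
Lemma cImM z w : Im (z * w) = Re z * Im w + Im z * Re w.
Proof. by case: z w => a b [c d]. Qed.
Lemma cReD z w : Re (z + w) = Re z + Re w.
Proof. by case: z w => a b [c d]. Qed.
Lemma cImD z w : Im (z + w) = Im z + Im w.
Proof. by case: z w => a b [c d]. Qed.
Lemma cReN z : Re (- z) = - Re z.
Proof. by case: z. Qed.
Lemma cImN z : Im (- z) = - Im z.
Proof. by case: z. Qed.
Lemma Reconj z : Re (conjc z) = Re z.
Proof. by case: z. Qed.
Lemma Imconj z : Im (conjc z) = - Im z.
Proof. by case: z. Qed.
Lemma complexP z w : Re z = Re w -> Im z = Im w -> z = w.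
Proof. by case: z w => a b [c d] /= -> ->. Qed.

Lemma conjc0 : conjc 0 = 0 :> C. Proof. exact: rmorph0. Qed.
Lemma conjc1 : conjc 1 = 1 :> C. Proof. exact: rmorph1. Qed.
Lemma conjcD z w : conjc (z + w) = conjc z + conjc w. Proof. exact: rmorphD. Qed.
Lemma conjcM z w : conjc (z * w) = conjc z * conjc w. Proof. exact: rmorphM. Qed.
Lemma conjcN z : conjc (- z) = - conjc z. Proof. exact: rmorphN. Qed.
Lemma conjc_sum I (r : seq I) (p : pred I) (F : I -> C) :
  conjc (\sum_(i <- r | p i) F i) = \sum_(i <- r | p i) conjc (F i).
Proof. exact: rmorph_sum. Qed.

Definition ReImE := (cReM, cImM, cReD, cImD, cReN, cImN, Reconj, Imconj).

Lemma cnorm2_ge0 z : 0 <= cnorm2 z.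
Proof. by rewrite /cnorm2 addr_ge0 ?sqr_ge0. Qed.
Lemma cnorm2M z w : cnorm2 (z * w) = cnorm2 z * cnorm2 w.
Proof. by rewrite /cnorm2 !ReImE; ring. Qed.
Lemma cnorm2_conj z : cnorm2 (conjc z) = cnorm2 z.
Proof. by rewrite /cnorm2 !ReImE; ring. Qed.
Lemma cnorm2N z : cnorm2 (- z) = cnorm2 z.
Proof. by rewrite /cnorm2 !ReImE; ring. Qed.
Lemma cnorm2D z w : cnorm2 (z + w) <= 2 * cnorm2 z + 2 * cnorm2 w.
Proof.
rewrite /cnorm2 !ReImE -subr_ge0.
rewrite (_ : _ - _ = (Re z - Re w) ^+ 2 + (Im z - Im w) ^+ 2); last by ring.
by rewrite addr_ge0 ?sqr_ge0.
Qed.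
Lemma cnorm2_eq0 z : cnorm2 z = 0 -> z = 0.
Proof.
move=> /eqP; rewrite /cnorm2 paddr_eq0 ?sqr_ge0// !sqrf_eq0 => /andP[/eqP a /eqP b].
exact: complexP.
Qed.
Lemma cnorm20 : cnorm2 (0 : C) = 0.
Proof. by rewrite /cnorm2 /= expr0n addr0. Qed.
Lemma cnorm21 : cnorm2 (1 : C) = 1.
Proof. by rewrite /cnorm2 /= expr0n addr0 expr1n. Qed.
Lemma conjcE z : z * conjc z = Complex (cnorm2 z) 0.
Proof. by apply: complexP; rewrite !ReImE /cnorm2 /=; ring. Qed.
Lemma normRe_le z : `|Re z| <= 1 + cnorm2 z.
Proof. by rewrite /cnorm2 ler_norml; apply/andP; split; nra. Qed.
Lemma Re_sum I (r : seq I) (p : pred I) (F : I -> C) :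
  Re (\sum_(i <- r | p i) F i) = \sum_(i <- r | p i) Re (F i).
Proof. by apply: (big_morph (@complex.Re R)) => // a b; rewrite cReD. Qed.
Lemma Im_sum I (r : seq I) (p : pred I) (F : I -> C) :
  Im (\sum_(i <- r | p i) F i) = \sum_(i <- r | p i) Im (F i).
Proof. by apply: (big_morph (@complex.Im R)) => // a b; rewrite cImD. Qed.

Definition aeT P := {ae mu, forall x, Tset x -> P x}.

#[local] Instance ae_lebesgue_filter : Filter (almost_everywhere mu).
Proof. exact: (ae_filter_ringOfSetsType mu). Qed.

Lemma aeTW P : (forall x, P x) -> aeT P.
Proof. by move=> h; apply: aeW => x _. Qed.
Lemma aeTS P Q : (forall x, P x -> Q x) -> aeT P -> aeT Q.
Proof. by rewrite /aeT => h; apply: (@filterS _ _ ae_lebesgue_filter) => x k Tx; exact/h/k. Qed.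
Lemma aeTS2 P Q P' : (forall x, P x -> Q x -> P' x) -> aeT P -> aeT Q -> aeT P'.
Proof. by rewrite /aeT => h; apply: (@filterS2 _ _ ae_lebesgue_filter) => x k l Tx; apply: h; [exact/k|exact/l]. Qed.
Lemma aeT_all (I : finType) (F : I -> R -> Prop) :
  (forall i, aeT (F i)) -> aeT (fun x => forall i, F i x).
Proof.
move=> h; have := @filter_forall _ I (fun i => [set x | Tset x -> F i x])
  _ ae_lebesgue_filter h.
by rewrite /aeT; apply: (@filterS _ _ ae_lebesgue_filter) => x k Tx i; exact: k.
Qed.

Lemma mT : measurable (@Tset R).
Proof. exact: measurable_itv. Qed.
Lemma mTR : @measurable _ (measurableTypeR R) (@Tset R).
Proof. exact: measurable_itv. Qed.
Lemma muT : mu (@Tset R) = 1%E.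
Proof. by rewrite lebesgue_measure_itv /= lte_fin ltr01 -EFinD subr0. Qed.
Hint Resolve mT : core.

(** The circle has measure 1, so it is not null. Contradictions that are reached pointwise, at
    almost every point, are closed through this lemma. *)
Lemma aeT_false : aeT (fun _ => False) -> False.
Proof.
move=> [N [mN N0 sub]].
suff : (mu (@Tset R) <= mu N)%E by rewrite muT N0 lee_fin ler10.
apply: le_measure; rewrite ?inE//.
by move=> x Tx; apply: sub => /= /(_ Tx).
Qed.

Definition Lr (f : R -> R) := mu.-integrable (@Tset R) (EFin \o f).

Lemma Lr_meas (f : R -> R) : Lr f -> measurable_fun (@Tset R) f.
Proof. by move=> /integrableP[/measurable_EFinP]. Qed.
Lemma Lr_dom (f g : R -> R) : measurable_fun (@Tset R) f ->
  (forall x, `|f x| <= g x) -> Lr g -> Lr f.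
Proof.
move=> mf fg; apply: le_integrable => //; first exact/measurable_EFinP.
by move=> x _ /=; rewrite lee_fin (le_trans (fg x))// ler_norm.
Qed.
Lemma LrD (f g : R -> R) : Lr f -> Lr g -> Lr (fun x => f x + g x).
Proof. exact: integrableD. Qed.
Lemma LrZ (c : R) (f : R -> R) : Lr f -> Lr (fun x => c * f x).
Proof. exact: integrableZl. Qed.
Lemma LrN (f : R -> R) : Lr f -> Lr (fun x => - f x).
Proof. exact: integrableN. Qed.
Lemma Lr_cst (c : R) : Lr (fun=> c).
Proof.
apply/integrableP; split; first exact/measurable_EFinP.
by rewrite /= integral_cst// [X in (_ * X)%E]muT mule1 ltry.
Qed.
Lemma Lr_sum I (r : seq I) (p : pred I) (F : I -> R -> R) :
  (forall i, p i -> Lr (F i)) -> Lr (fun x => \sum_(i <- r | p i) F i x).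
Proof.
move=> h; elim: r => [|i r ih].
  by rewrite (_ : (fun _ => _) = fun=> 0); [exact: Lr_cst|apply/funext => x; rewrite big_nil].
rewrite (_ : (fun _ => _) = fun x => if p i then F i x + \sum_(j <- r | p j) F j x else
   \sum_(j <- r | p j) F j x); last by apply/funext => x; rewrite big_cons.
by case E: (p i) => //; apply: LrD => //; exact: h.
Qed.

Definition L1c f := Lr (fun x => Re (f x)) /\ Lr (fun x => Im (f x)).

Lemma L1cD f g : L1c f -> L1c g -> L1c (fun x => f x + g x).
Proof.
move=> [f1 f2] [g1 g2]; split.
- by under eq_fun do rewrite cReD; exact: LrD.
- by under eq_fun do rewrite cImD; exact: LrD.
Qed.
Lemma L1cZ c f : L1c f -> L1c (fun x => c * f x).
Proof.
move=> [f1 f2]; split.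
- under eq_fun do rewrite cReM -mulNr.
  by apply: LrD; exact: LrZ.
- under eq_fun do rewrite cImM.
  by apply: LrD; exact: LrZ.
Qed.
Lemma L1c_conj f : L1c f -> L1c (fun x => conjc (f x)).
Proof.
move=> [f1 f2]; split.
- by under eq_fun do rewrite Reconj.
- by under eq_fun do rewrite Imconj; exact: LrN.
Qed.
Lemma L1c_sum I (r : seq I) (p : pred I) (F : I -> cfun R) :
  (forall i, p i -> L1c (F i)) -> L1c (fun x => \sum_(i <- r | p i) F i x).
Proof.
move=> h; split.
- by under eq_fun do rewrite Re_sum; apply: Lr_sum => i /h[].
- by under eq_fun do rewrite Im_sum; apply: Lr_sum => i /h[].
Qed.

Lemma cintD f g : L1c f -> L1c g -> cint (fun x => f x + g x) = cint f + cint g.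
Proof.
move=> [f1 f2] [g1 g2]; apply: complexP; rewrite ?ReImE /cint /= -RintegralD//;
  by apply: eq_Rintegral => x _; rewrite ?ReImE.
Qed.
Lemma cintZ c f : L1c f -> cint (fun x => c * f x) = c * cint f.
Proof.
move=> [f1 f2]; apply: complexP; rewrite ReImE /cint /= -!RintegralZl//.
- rewrite -RintegralB//; try exact: LrZ.
  by apply: eq_Rintegral => x _; rewrite ReImE.
- rewrite -RintegralD//; try exact: LrZ.
  by apply: eq_Rintegral => x _; rewrite ReImE.
Qed.
Lemma cint_conj f : L1c f -> cint (fun x => conjc (f x)) = conjc (cint f).
Proof.
move=> [f1 f2]; apply: complexP; rewrite ReImE /cint /=.
  by apply: eq_Rintegral => x _; rewrite ?ReImE.
rewrite -mulN1r -RintegralZl//.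
by apply: eq_Rintegral => x _; rewrite ?ReImE mulN1r.
Qed.
Lemma cint0 : cint (fun _ : R => 0 : C) = 0 :> C.
Proof. by apply: complexP; rewrite /cint /= /Rintegral integral0. Qed.
Lemma cint_cst (c : C) : cint (fun _ : R => c) = c.
Proof.
by apply: complexP; rewrite /cint /= Rintegral_cst// [X in fine X]muT/= mulr1.
Qed.
Lemma cint_sum I (r : seq I) (p : pred I) (F : I -> cfun R) :
  (forall i, p i -> L1c (F i)) ->
  cint (fun x => \sum_(i <- r | p i) F i x) = \sum_(i <- r | p i) cint (F i).
Proof.
move=> h; elim: r => [|i r ih].
  rewrite big_nil -[RHS]cint0; congr cint; apply/funext => x; exact: big_nil.
rewrite big_cons -ih; case: ifPn => pi; last first.
  by congr cint; apply/funext => x; rewrite big_cons (negbTE pi).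
rewrite -cintD; [|exact: h|exact: L1c_sum].
by congr cint; apply/funext => x; rewrite big_cons pi.
Qed.

Lemma Rint_ae (f g : R -> R) : measurable_fun (@Tset R) f -> measurable_fun (@Tset R) g ->
  aeT (fun x => f x = g x) ->
  \int[mu]_(x in @Tset R) f x = \int[mu]_(x in @Tset R) g x.
Proof.
move=> mf mg fg; rewrite /Rintegral; congr fine.
apply: ae_eq_integral => //; try exact/measurable_EFinP.
by apply: (@filterS _ _ ae_lebesgue_filter) fg => x /= h Tx; rewrite h.
Qed.
Lemma cint_ae f g : cmeasurable f -> cmeasurable g -> aeT (fun x => f x = g x) ->
  cint f = cint g.
Proof.
by move=> [f1 f2] [g1 g2] fg; apply: complexP; apply: Rint_ae => //;
  apply: aeTS fg => x ->.
Qed.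

Lemma cmeasD f g : cmeasurable f -> cmeasurable g -> cmeasurable (fun x => f x + g x).
Proof.
move=> [f1 f2] [g1 g2]; split.
- by under eq_fun do rewrite cReD; exact: measurable_funD.
- by under eq_fun do rewrite cImD; exact: measurable_funD.
Qed.
Lemma cmeasM f g : cmeasurable f -> cmeasurable g -> cmeasurable (fun x => f x * g x).
Proof.
move=> [f1 f2] [g1 g2]; split.
- by under eq_fun do rewrite cReM; apply: measurable_funB; exact: measurable_funM.
- by under eq_fun do rewrite cImM; apply: measurable_funD; exact: measurable_funM.
Qed.
Lemma cmeas_conj f : cmeasurable f -> cmeasurable (fun x => conjc (f x)).
Proof.
move=> [f1 f2]; split.
- by under eq_fun do rewrite Reconj.
- by under eq_fun do rewrite Imconj; exact: measurableT_comp.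
Qed.
Lemma cmeas_cst c : cmeasurable (fun _ : R => c : C).
Proof. by split; exact: measurable_cst. Qed.
Lemma cmeas_sum I (r : seq I) (p : pred I) (F : I -> cfun R) :
  (forall i, p i -> cmeasurable (F i)) -> cmeasurable (fun x => \sum_(i <- r | p i) F i x).
Proof.
move=> h; elim: r => [|i r ih].
  rewrite (_ : (fun _ => _) = fun=> 0); first exact: cmeas_cst.
  by apply/funext => x; rewrite big_nil.
rewrite (_ : (fun _ => _) = fun x => if p i then F i x + \sum_(j <- r | p j) F j x else
   \sum_(j <- r | p j) F j x); last by apply/funext => x; rewrite big_cons.
by case E: (p i) => //; apply: cmeasD => //; exact: h.
Qed.
Lemma meas_cnorm2 f : cmeasurable f -> measurable_fun (@Tset R) (fun x => cnorm2 (f x)).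
Proof. by move=> [f1 f2]; apply: measurable_funD; exact: measurable_funX. Qed.
Lemma L1c_meas f : L1c f -> cmeasurable f.
Proof. by move=> [/Lr_meas ? /Lr_meas ?]. Qed.

Lemma L2cP f : L2c f <-> cmeasurable f /\ Lr (fun x => cnorm2 (f x)).
Proof.
split=> [[mf fo]|[mf /integrableP[_ fo]]]; split=> //.
- apply/integrableP; split; first by apply/measurable_EFinP; exact: meas_cnorm2.
  congr (_ < _)%E: fo; apply: eq_integral => x _.
  by rewrite /= ger0_norm ?cnorm2_ge0.
- congr (_ < _)%E: fo; apply: eq_integral => x _.
  by rewrite /= ger0_norm ?cnorm2_ge0.
Qed.
Lemma L2c_meas f : L2c f -> cmeasurable f. Proof. by case. Qed.
Lemma L2c_int f : L2c f -> Lr (fun x => cnorm2 (f x)). Proof. by move/L2cP => []. Qed.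
Hint Resolve L2c_meas L2c_int : core.

Lemma normReM z w : `|Re (z * w)| <= cnorm2 z + cnorm2 w.
Proof.
rewrite cReM /cnorm2 ler_norml.
have := sqr_ge0 (Re z + Re w); have := sqr_ge0 (Re z - Re w).
have := sqr_ge0 (Im z + Im w); have := sqr_ge0 (Im z - Im w).
by move=> *; apply/andP; split; nra.
Qed.
Lemma normImM z w : `|Im (z * w)| <= cnorm2 z + cnorm2 w.
Proof.
rewrite cImM /cnorm2 ler_norml.
have := sqr_ge0 (Re z + Im w); have := sqr_ge0 (Re z - Im w).
have := sqr_ge0 (Im z + Re w); have := sqr_ge0 (Im z - Re w).
by move=> *; apply/andP; split; nra.
Qed.

Lemma L1cM f g : L2c f -> L2c g -> L1c (fun x => f x * g x).
Proof.
move=> hf hg; have [m1 m2] := cmeasM (L2c_meas hf) (L2c_meas hg).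
by split; [apply: Lr_dom m1 _ (LrD (L2c_int hf) (L2c_int hg)) => x; exact: normReM
          |apply: Lr_dom m2 _ (LrD (L2c_int hf) (L2c_int hg)) => x; exact: normImM].
Qed.
Lemma L2cD f g : L2c f -> L2c g -> L2c (fun x => f x + g x).
Proof.
move=> hf hg; apply/L2cP; split; first exact: cmeasD (L2c_meas hf) (L2c_meas hg).
apply: Lr_dom (LrD (LrZ 2 (L2c_int hf)) (LrZ 2 (L2c_int hg))).
  by apply: meas_cnorm2; exact: cmeasD (L2c_meas hf) (L2c_meas hg).
by move=> x; rewrite ger0_norm ?cnorm2_ge0// cnorm2D.
Qed.
(** The bound on [u] holds only almost everywhere, as it does in [Hinf]. The domination lemma
    [Lr_dom] is pointwise, so the integrals themselves are compared. *)
Lemma L2c_bddM u f (M : R) : cmeasurable u -> aeT (fun x => cnorm2 (u x) <= M) ->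
  L2c f -> L2c (fun x => u x * f x).
Proof.
move=> mu_ bu hf; split; first exact: cmeasM mu_ (L2c_meas hf).
have [_ ] := integrableP _ _ _ (LrZ M (L2c_int hf)).
apply: le_lt_trans; apply: ae_ge0_le_integral => //.
- by move=> x _; rewrite lee_fin cnorm2_ge0.
- by apply/measurable_EFinP; apply: meas_cnorm2; exact: cmeasM mu_ (L2c_meas hf).
- apply: measurableT_comp => //; apply/measurable_EFinP.
  by apply: measurable_funM => //; by apply: meas_cnorm2; exact: L2c_meas.
apply: (@filterS _ _ ae_lebesgue_filter) bu => x /= h Tx; rewrite lee_fin cnorm2M.
by rewrite (le_trans _ (ler_norm _))// ler_wpM2r ?cnorm2_ge0// h.
Qed.
Lemma L2c_cst c : L2c (fun _ : R => c : C).
Proof. by apply/L2cP; split; [exact: cmeas_cst|exact: Lr_cst]. Qed.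
Lemma L2cZ c f : L2c f -> L2c (fun x => c * f x).
Proof.
apply: (@L2c_bddM _ _ (cnorm2 c)); first exact: cmeas_cst.
exact: aeTW.
Qed.
Lemma L2c_conj f : L2c f -> L2c (fun x => conjc (f x)).
Proof.
move=> hf; apply/L2cP; split; first exact/cmeas_conj/L2c_meas.
by under eq_fun do rewrite cnorm2_conj; exact: L2c_int.
Qed.
Lemma L2c_sum I (r : seq I) (p : pred I) (F : I -> cfun R) :
  (forall i, p i -> L2c (F i)) -> L2c (fun x => \sum_(i <- r | p i) F i x).
Proof.
move=> h; elim: r => [|i r ih].
  rewrite (_ : (fun _ => _) = fun=> 0); first exact: L2c_cst.
  by apply/funext => x; rewrite big_nil.
rewrite (_ : (fun _ => _) = fun x => if p i then F i x + \sum_(j <- r | p j) F j x else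
   \sum_(j <- r | p j) F j x); last by apply/funext => x; rewrite big_cons.
by case E: (p i) => //; apply: L2cD => //; exact: h.
Qed.
Lemma L2c_bdd u (M : R) : cmeasurable u -> aeT (fun x => cnorm2 (u x) <= M) -> L2c u.
Proof.
move=> hu bu; have := L2c_bddM hu bu (L2c_cst 1).
by under eq_fun do rewrite mulr1.
Qed.
Lemma L2c_L1 f : L2c f -> L1c f.
Proof.
move=> /(L1cM (L2c_cst 1)).
by under [X in L1c X]eq_fun do rewrite mul1r.
Qed.

End Base.

(** * Trigonometric monomials and their integrals *)

Section Trig.
Variable R : realType.
Local Notation C := R[i].
Local Notation mu := (@lebesgue_measure R).
Local Notation Re := complex.Re.
Local Notation Im := complex.Im.

Lemma zpow0 (x : R) : zpow 0 x = 1.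
Proof. by rewrite /zpow mulr0 mul0r cos0 sin0. Qed.
Lemma zpowD (k l : int) (x : R) : zpow (k + l) x = zpow k x * zpow l x.
Proof.
rewrite /zpow rmorphD /= mulrDr mulrDl cosD sinD.
by apply: complexP; rewrite ReImE /=; ring.
Qed.
Lemma zpow_conj (k : int) (x : R) : conjc (zpow k x) = zpow (- k) x.
Proof. by rewrite /zpow rmorphN /= mulrN mulNr cosN sinN. Qed.
Lemma zpowNK (k : int) (x : R) : zpow (- k) x * zpow k x = 1.
Proof. by rewrite -zpowD addNr zpow0. Qed.
Lemma cnorm2_zpow (k : int) (x : R) : cnorm2 (zpow k x) = 1.
Proof. by rewrite /cnorm2 /zpow /= cos2Dsin2. Qed.
(** Periodicity at the end point of the parameter interval: the primitives used in [cint_zpow] take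
    the same value at 0 and at 1. *)
Lemma zpow1 (k : int) : zpow k (1 : R) = 1.
Proof.
have h1 : zpow 1 (1 : R) = 1.
  by rewrite /zpow !mulr1 mulr_natl cos2pi sin2pi.
have hN : zpow (-1) (1 : R) = 1 by rewrite -zpow_conj h1 rmorph1.
by elim: k => [|k ih|k ih]; rewrite ?zpow0// ?intS ?opprD zpowD ?h1 ?hN mul1r.
Qed.

Lemma is_derive_sinM (a x : R) : is_derive x 1 (fun t => sin (a * t)) (a * cos (a * x)).
Proof.
have h : is_derive x 1 (fun t : R => a * t) a.
  by apply: is_derive_eq; rewrite [_ *: _]mulr1.
have := @is_derive1_comp _ sin (fun t => a * t) x _ _ (is_derive_sin _) h.
by move=> /is_derive_eq; apply; rewrite mulrC.
Qed.
Lemma is_derive_cosM (a x : R) : is_derive x 1 (fun t => cos (a * t)) (- (a * sin (a * x))).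
Proof.
have h : is_derive x 1 (fun t : R => a * t) a.
  by apply: is_derive_eq; rewrite [_ *: _]mulr1.
have := @is_derive1_comp _ cos (fun t => a * t) x _ _ (is_derive_cos _) h.
by move=> /is_derive_eq; apply; rewrite mulNr mulrC.
Qed.

Lemma continuous_cosM (a : R) : continuous (fun t : R => cos (a * t)).
Proof.
by move=> x; apply: differentiable_continuous; apply/derivable1_diffP; case: (is_derive_cosM a x).
Qed.
Lemma continuous_sinM (a : R) : continuous (fun t : R => sin (a * t)).
Proof.
by move=> x; apply: differentiable_continuous; apply/derivable1_diffP; case: (is_derive_sinM a x).
Qed.

Lemma zpow_meas (k : int) : cmeasurable (@zpow R k).
Proof.
split; apply: (@measurable_funS _ _ _ _ setT) => //; apply: continuous_measurable_fun.
- exact: continuous_cosM.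
- exact: continuous_sinM.
Qed.

Lemma Rint_FTC (F f : R -> R) : (forall x : R, is_derive x 1 F (f x)) -> continuous f ->
  \int[mu]_(x in @Tset R) f x = F 1 - F 0.
Proof.
move=> dF cf; have cF : continuous F.
  by move=> x; apply: differentiable_continuous; apply/derivable1_diffP; case: (dF x).
rewrite /Rintegral (@continuous_FTC2 _ f F)//.
- exact: continuous_subspaceT.
- split.
  + by move=> x _; case: (dF x).
  + exact/cvg_at_right_filter/cF.
  + exact/cvg_at_left_filter/cF.
- by move=> x _; rewrite derive1E; case: (dF x).
Qed.

Lemma cint_zpow (k : int) : k != 0 -> cint (@zpow R k) = 0.
Proof.
move=> k0; set a := 2 * pi * k%:~R : R.
have a0 : a != 0.
  apply: mulf_neq0; last by rewrite intr_eq0.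
  by rewrite mulf_neq0// ?pnatr_eq0// gt_eqF// pi_gt0.
have [c1 s1] : cos a = 1 /\ sin a = 0.
  by have := zpow1 k; rewrite /zpow mulr1 => -[].
apply: complexP; rewrite /cint /=.
- have dF (x : R) : is_derive x 1 (fun t => a^-1 * sin (a * t)) (cos (a * x)).
    have h := is_derive_sinM a x; apply: is_derive_eq.
    by rewrite -[LHS]/(a^-1 * (a * cos (a * x))) mulKf.
  rewrite (Rint_FTC dF); last exact: continuous_cosM.
  by rewrite mulr1 mulr0 s1 sin0 subrr.
- have dF (x : R) : is_derive x 1 (fun t => - a^-1 * cos (a * t)) (sin (a * x)).
    have h := is_derive_cosM a x; apply: is_derive_eq.
    by rewrite -[LHS]/(- a^-1 * - (a * sin (a * x))) mulrNN mulKf.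
  rewrite (Rint_FTC dF); last exact: continuous_sinM.
  by rewrite mulr1 mulr0 c1 cos0 subrr.
Qed.

Lemma L2c_zpowM (k : int) (f : cfun R) : L2c f -> L2c (fun x => zpow k x * f x).
Proof.
apply: (@L2c_bddM _ _ _ 1); first exact: zpow_meas.
by apply: aeTW => x; rewrite cnorm2_zpow.
Qed.
Lemma L2c_zpow (k : int) : L2c (@zpow R k).
Proof.
apply: (@L2c_bdd _ _ 1); first exact: zpow_meas.
by apply: aeTW => x; rewrite cnorm2_zpow.
Qed.

End Trig.

(** * The inner product on L^2 vectors *)

Section InnerProduct.
Variable R : realType.
Local Notation C := R[i].
Local Notation mu := (@lebesgue_measure R).
Local Notation Re := complex.Re.
Local Notation Im := complex.Im.
Variable n : nat.
Implicit Types (f g h v p : vfun R n) (V : vfun R n -> Prop).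

Definition L2v f := forall i, L2c (f i).
Definition ip f g : C := cint (fun x => \sum_i f i x * conjc (g i x)).
Definition nrm2 f : R := Re (ip f f).
(** A single operation carries all linear structure: differences are the case c = -1, and a nonempty
    predicate stable under [lc] is a linear subspace. *)
Definition lc (c : C) f g : vfun R n := fun i x => f i x + c * g i x.
Definition smul (u : cfun R) f : vfun R n := fun i x => u x * f i x.
Definition nullv f := aeT (fun x => forall i, f i x = 0).
(** Membership in the L^2 closure of [V], through squared distances. It is insensitive to null sets
    even when [V] is not. *)
Definition nearV V p := forall eps : R, 0 < eps -> exists v, V v /\ nrm2 (lc (-1) p v) < eps.

Lemma L2v_lc c f g : L2v f -> L2v g -> L2v (lc c f g).
Proof. by move=> hf hg i; apply: L2cD => //; exact: L2cZ. Qed.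
Lemma L2v_zpow k f : L2v f -> L2v (smul (zpow k) f).
Proof. by move=> hf i; exact: L2c_zpowM. Qed.
Lemma ip_L1 f g : L2v f -> L2v g -> L1c (fun x => \sum_i f i x * conjc (g i x)).
Proof. by move=> hf hg; apply: L1c_sum => i _; apply: L1cM => //; exact: L2c_conj. Qed.
Lemma ip_conj f g : L2v f -> L2v g -> ip g f = conjc (ip f g).
Proof.
move=> hf hg; rewrite /ip -cint_conj; last exact: ip_L1.
congr cint; apply/funext => x; rewrite conjc_sum; apply: eq_bigr => i _.
by rewrite conjcM conjcK mulrC.
Qed.
Lemma ip_lcl c f g h : L2v f -> L2v g -> L2v h -> ip (lc c f g) h = ip f h + c * ip g h.
Proof.
move=> hf hg hh; rewrite /ip -cintZ; last exact: ip_L1.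
rewrite -cintD; [|exact: ip_L1|by apply: L1cZ; exact: ip_L1].
congr cint; apply/funext => x; rewrite mulr_sumr -big_split; apply: eq_bigr => i _ /=.
by rewrite /lc mulrDl mulrA.
Qed.
Lemma ip_lcr c f g h : L2v f -> L2v g -> L2v h -> ip h (lc c f g) = ip h f + conjc c * ip h g.
Proof.
move=> hf hg hh; have hl := L2v_lc c hf hg.
by rewrite (ip_conj hl)// ip_lcl// conjcD conjcM -!ip_conj.
Qed.
Lemma nrm2E f : nrm2 f = \int[mu]_(x in @Tset R) \sum_i cnorm2 (f i x).
Proof.
rewrite /nrm2 /ip /cint /=; apply: eq_Rintegral => x _.
by rewrite Re_sum; apply: eq_bigr => i _; rewrite conjcE.
Qed.
Lemma nrm2_ge0 f : 0 <= nrm2 f.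
Proof.
by rewrite nrm2E; apply: Rintegral_ge0 => x _; apply: sumr_ge0 => i _; exact: cnorm2_ge0.
Qed.
Lemma ipff f : ip f f = Complex (nrm2 f) 0.
Proof.
apply: complexP => //=; rewrite /ip /cint /= /Rintegral.
rewrite (_ : (fun x => _) = fun=> 0%E) ?integral0//.
by apply/funext => x; rewrite Im_sum big1// => i _; rewrite conjcE.
Qed.
Lemma Lr_nrm2 f : L2v f -> Lr (fun x => \sum_i cnorm2 (f i x)).
Proof. by move=> hf; apply: Lr_sum => i _; exact: L2c_int. Qed.
Lemma vnorm2E f : L2v f -> vnorm2 f = (nrm2 f)%:E.
Proof.
move=> /Lr_nrm2 hf; rewrite nrm2E /vnorm2 /Rintegral fineK//.
by apply: integrable_fin_num => //; exact: mT.
Qed.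
Lemma nrm2_eq0 f : L2v f -> nrm2 f = 0 -> nullv f.
Proof.
move=> hf h0; have /integrableP[mf _] := Lr_nrm2 hf.
have /(ae_eq_integral_abs mu (@mT R) mf) : (\int[mu]_(x in @Tset R)
    `|(EFin \o (fun x => (\sum_i cnorm2 (f i x))%R)) x|)%E = 0.
  transitivity (vnorm2 f); last by rewrite vnorm2E// h0.
  apply: eq_integral => x _ /=.
  rewrite ger0_norm//; apply: sumr_ge0 => i _; exact: cnorm2_ge0.
apply: (@filterS _ _ (ae_lebesgue_filter R)) => x /= e Tx i; apply: cnorm2_eq0.
have /eqP := e Tx; rewrite eqe psumr_eq0 => [|j _]; last exact: cnorm2_ge0.
by move=> /allP/(_ i (mem_index_enum _))/eqP.
Qed.
Lemma nrm2_lc c f g : L2v f -> L2v g ->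
  nrm2 (lc c f g) = nrm2 f + 2 * Re (c * ip g f) + cnorm2 c * nrm2 g.
Proof.
move=> hf hg; have hl := L2v_lc c hf hg.
rewrite {1}/nrm2 ip_lcl// !ip_lcr// (ip_conj hg hf) !ipff !ReImE /= /cnorm2; ring.
Qed.

Lemma ip_CauchySchwarz f g : L2v f -> L2v g -> cnorm2 (ip f g) <= nrm2 f * nrm2 g.
Proof.
move=> hf hg; set P := cnorm2 (ip f g); set A := nrm2 f; set B := nrm2 g.
have P0 : 0 <= P := cnorm2_ge0 _.
(* This is the nonnegativity of the squared norm of f - l <f,g> g for real l. The value l = 1/B
   gives the inequality; if B = 0 and P > 0, the value l = (A + 1)/(2P) would make the expression
   equal to -1. *)
have key (l : R) : 0 <= A - 2 * l * P + l ^+ 2 * P * B.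
  have := nrm2_ge0 (lc (- (Complex l 0) * ip f g) f g); rewrite nrm2_lc//.
  rewrite (ip_conj hf hg) cnorm2M cnorm2N -[X in complex.Re X]mulrA conjcE -/P -/A -/B.
  rewrite [cnorm2 (Complex _ _)]/cnorm2 cReM cReN cImN /=.
  by congr (_ <= _); ring.
have A0 : 0 <= A := nrm2_ge0 _.
have [B0|B0] := eqVneq B 0.
  rewrite B0 mulr0.
  have [//|Pp] := leP P 0.
  have := key ((A + 1) / (2 * P)).
  rewrite B0 mulr0 addr0 (_ : 2 * _ * P = A + 1); last first.
    by field; rewrite gt_eqF.
  by move=> /=; lra.
have Bp : 0 < B by rewrite lt_neqAle eq_sym B0 nrm2_ge0.
have := key B^-1; rewrite (_ : _ + _ = A - P / B); last by field.
by rewrite subr_ge0 ler_pdivrMr.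
Qed.

(** For v in [V] one has <p,h> = <p - v,h>, which Cauchy-Schwarz makes small. Every condition that
    has to pass to a limit, including the vanishing of a Fourier coefficient, is put in this
    form. *)
Lemma nearV_orth V p h : L2v p -> L2v h -> (forall v, V v -> L2v v /\ ip v h = 0) ->
  nearV V p -> ip p h = 0.
Proof.
move=> hp hh hV np; apply: cnorm2_eq0; apply/eqP; rewrite eq_le cnorm2_ge0 andbT.
rewrite leNgt; apply/negP => P0.
have N0 : 0 < nrm2 h + 1 by rewrite ltr_wpDl// nrm2_ge0.
have [v [Vv]] := np _ (divr_gt0 P0 N0); have [hv vh] := hV v Vv.
have := ip_CauchySchwarz (L2v_lc (-1) hp hv) hh.
rewrite ip_lcl// vh mulr0 addr0 ltr_pdivlMr// => h1 h2.
suff : cnorm2 (ip p h) < cnorm2 (ip p h) by rewrite ltxx.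
apply: le_lt_trans h1 (le_lt_trans _ h2).
by rewrite ler_wpM2l ?nrm2_ge0// lerDl.
Qed.

Lemma ip_zpow k f g : ip (smul (zpow k) f) g = ip f (smul (zpow (- k)) g).
Proof.
congr cint; apply/funext => x; apply: eq_bigr => i _.
by rewrite /smul conjcM -zpow_conj conjcK; ring.
Qed.
Lemma ip_ext f f' g g' : L2v f -> L2v f' -> L2v g -> L2v g' ->
  aeT (fun x => forall i, f i x = f' i x) -> aeT (fun x => forall i, g i x = g' i x) ->
  ip f g = ip f' g'.
Proof.
move=> hf hf' hg hg' e1 e2; apply: cint_ae; try by apply: L1c_meas; exact: ip_L1.
by apply: aeTS2 e1 e2 => x a b; apply: eq_bigr => i _; rewrite a b.
Qed.
Lemma ip_eq0 f g : L2v f -> L2v g -> nullv f -> ip f g = 0.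
Proof.
move=> hf hg e1; rewrite -(cint0 R); apply: cint_ae.
- by apply: L1c_meas; exact: ip_L1.
- exact: cmeas_cst.
- by apply: aeTS e1 => x h; rewrite big1// => i _; rewrite h mul0r.
Qed.

End InnerProduct.

(** * Completeness and orthogonal projections *)

Section Completeness.
Variable R : realType.
Local Notation C := R[i].
Local Notation mu := (@lebesgue_measure R).
Local Notation Re := complex.Re.
Local Notation Im := complex.Im.
Local Notation T := (@Tset R).
Let mT_ : measurable T := @mT R.
Hint Resolve mT_ : core.
Let mTR_ := @mTR R.
Hint Resolve mTR_ : core.

Lemma limn_einf_le (u : (\bar R)^nat) (c : \bar R) (m : nat) :
  (forall k, (m <= k)%N -> (u k <= c)%E) -> (limn_einf u <= c)%E.
Proof.
move=> h; rewrite limn_einf_lim; apply: lime_le; first exact: is_cvg_einfs.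
by exists m => // k /h; apply: le_trans; apply: ereal_inf_lbound; exists k => /=.
Qed.

Lemma expr_small (a C eps : R) : 0 <= a < 1 -> 0 < eps -> exists k, C * a ^+ k < eps.
Proof.
move=> /andP[a0 a1] e0.
have ha : `|a| < 1 by rewrite ger0_norm.
have hc : (fun k => C * a ^+ k) @ \oo --> (0 : R).
  by rewrite -(mulr0 C); apply: cvgM; [exact: cvg_cst|exact: cvg_expr].
have /cvgrPdist_lt/(_ _ e0)[k _ /(_ k (leqnn k))] := hc; rewrite /=.
rewrite sub0r normrN => h; exists k; apply: le_lt_trans h; exact: ler_norm.
Qed.

Lemma expr_le0 (a C x : R) : 0 <= a < 1 -> (forall k, x <= C * a ^+ k) -> x <= 0.
Proof.
move=> ha h; rewrite leNgt; apply/negP => x0.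
have [k /lt_le_trans/(_ (h k))] := expr_small C ha x0.
by rewrite ltxx.
Qed.

Lemma sum_half (m : nat) : \sum_(0 <= k < m) (2^-1 : R) ^+ k <= 2.
Proof.
suff -> : \sum_(0 <= k < m) (2^-1 : R) ^+ k = 2 - 2 * 2^-1 ^+ m.
  by rewrite gerBl mulr_ge0// exprn_ge0.
elim: m => [|m ih]; first by rewrite big_nil expr0; lra.
by rewrite big_nat_recr//= ih exprS; lra.
Qed.

Lemma cvg_bounded_variation (u : R^nat) (B : R) :
  (forall m, \sum_(0 <= k < m) `|u k.+1 - u k| <= B) -> cvgn u.
Proof.
move=> h; have cs : cvgn (series (telescope u)).
  apply: normed_cvg; apply: nondecreasing_is_cvgn.
    move=> a b ab; rewrite /series /= [leRHS](big_cat_nat (n := a))//= lerDl.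
    by apply: sumr_ge0.
  by exists B => _ [m _ <-]; exact: h.
have -> : u = (fun m => u 0%N + series (telescope u) m).
  by apply/funext => m; rewrite -eq_sum_telescope.
by apply: is_cvgD => //; exact: is_cvg_cst.
Qed.

(** By monotone convergence the sum of the increments has finite integral, so it is finite outside a
    null set, where the sequence has bounded variation. *)
Lemma ae_cvg_of_summable (u : nat -> R -> R) (B : R) :
  (forall k, measurable_fun T (u k)) ->
  (forall k, (\int[mu]_(x in T) `|u k.+1 x - u k x|%:E <= (B * 2^-1 ^+ k)%:E)%E) ->
  exists w : R -> R, measurable_fun T w /\ aeT (fun x => u ^~ x @ \oo --> w x).
Proof.
move=> mu_ hB.
have md k : measurable_fun T (fun x => `|u k.+1 x - u k x|%:E).
  by apply/measurable_EFinP; apply: measurableT_comp => //; exact: measurable_funB.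
pose S x := (\sum_(0 <= k <oo) `|u k.+1 x - u k x|%:E)%E.
have S0 x : (0 <= S x)%E by apply: nneseries_ge0 => k _ _; rewrite lee_fin.
have mS : measurable_fun T S.
  by apply: ge0_emeasurable_sum => // k x _ _; rewrite lee_fin.
have iS : mu.-integrable T S.
  apply/integrableP; split => //.
  under eq_integral do rewrite gee0_abs//.
  rewrite integral_nneseries//.
  apply: (@le_lt_trans _ _ (2 * `|B|)%:E); last by rewrite ltry.
  apply: lime_le.
    by apply: is_cvg_nneseries => k _ _; apply: integral_ge0 => x _; rewrite lee_fin.
  apply: nearW => m.
  apply: (@le_trans _ _ (\sum_(0 <= k < m) (`|B| * 2^-1 ^+ k)%:E)%E).
    apply: lee_sum => k _; apply: le_trans (hB k) _.
    by rewrite lee_fin ler_wpM2r ?exprn_ge0// ler_norm.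
  by rewrite sumEFin lee_fin -mulr_sumr mulrC ler_wpM2r// sum_half.
have /integrable_ae := iS; move=> /(_ (@mTR R))[N [mN N0 sN]].
(* Cutting off the null set gives convergence at every point of the circle, from which the
   measurability of the limit follows. *)
pose u' k x := u k x * \1_(~` N) x.
have cu' x : T x -> cvgn (u' ^~ x).
  move=> Tx; have [xN|xN] := pselect (N x).
    rewrite (_ : u' ^~ x = fun=> 0); first exact: is_cvg_cst.
    by apply/funext => k; rewrite /u' indicE in_setC mem_set//= mulr0.
  have fS : S x \is a fin_num by apply: contrapT => h; apply: xN; apply: sN => /= /(_ Tx).
  apply: (@cvg_bounded_variation _ (fine (S x))) => m.
  rewrite -lee_fin fineK// -sumEFin.
  have h0 k : (0 <= k)%N -> true -> (0 <= `|u k.+1 x - u k x|%:E)%E by rewrite lee_fin.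
  apply: le_trans (nneseries_lim_ge m h0).
  apply: lee_sum => k _; rewrite lee_fin /u' -mulrBl normrM.
  by rewrite ler_piMr// indicE; case: (_ \in _); rewrite ?normr1 ?normr0.
exists (fun x => limn (u' ^~ x)); split.
  apply: (@measurable_fun_cvg _ _ _ _ u') => // k.
  apply: measurable_funM => //; apply: measurable_indic; exact: measurableC.
exists N; split=> // x /= h; apply: contrapT => xN; apply: h => Tx.
rewrite (_ : u ^~ x = u' ^~ x); first exact: cu'.
apply/funext => k; by rewrite /u' indicE in_setC memNset//= mulr1.
Qed.

Lemma cnorm2_cvg (u : nat -> C) (a b : R) (w : C) :
  Re (u k) @[k --> \oo] --> a -> Im (u k) @[k --> \oo] --> b ->
  cnorm2 (u k - w) @[k --> \oo] --> cnorm2 (Complex a b - w).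
Proof.
move=> ha hb; rewrite /cnorm2 !cReD !cImD !cReN !cImN /=.
under eq_fun do rewrite !cReD !cImD !cReN !cImN.
apply: cvgD; rewrite expr2; (under eq_fun do rewrite expr2); apply: cvgM;
  by apply: cvgB => //; exact: cvg_cst.
Qed.

Lemma cvg_sumr (I : Type) (r : seq I) (u : I -> nat -> R) (l : I -> R) :
  (forall i, u i @ \oo --> l i) ->
  (\sum_(i <- r) u i k) @[k --> \oo] --> \sum_(i <- r) l i.
Proof.
move=> h; elim: r => [|i r ih].
  by rewrite big_nil; under eq_fun do rewrite big_nil; exact: cvg_cst.
by rewrite big_cons; under eq_fun do rewrite big_cons; exact: cvgD.
Qed.

Lemma norm_AMGM (a t : R) : 0 < t -> `|a| <= t * a ^+ 2 + t^-1.
Proof.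
move=> t0; rewrite -(ler_pM2l t0) mulrDr mulfV ?gt_eqF// -real_normK ?num_real//.
set b := `|a|; have := sqr_ge0 (t * b - 1); have := sqr_ge0 (t * b); lra.
Qed.

Lemma Rint_le_ereal (f : R -> R) (c : R) : (forall x, 0 <= f x) -> Lr f ->
  (\int[mu]_(x in T) (f x)%:E <= c%:E)%E <-> \int[mu]_(x in T) f x <= c.
Proof.
move=> f0 hf; rewrite /Rintegral -lee_fin fineK//.
by apply: integrable_fin_num => //.
Qed.

(** The inequality |d| <= t d^2 + 1/t with t = 2^k converts the bound B 4^(-k) on the squared L^2
    norm into the summable L^1 bound (B + 1) 2^(-k). *)
Lemma ae_cvg_L2 (u : nat -> R -> R) (B : R) :
  (forall k, measurable_fun T (u k)) ->
  (forall k, Lr (fun x => (u k.+1 x - u k x) ^+ 2)) ->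
  (forall k, \int[mu]_(x in T) (u k.+1 x - u k x) ^+ 2 <= B * 4^-1 ^+ k) ->
  exists w : R -> R, measurable_fun T w /\ aeT (fun x => u ^~ x @ \oo --> w x).
Proof.
move=> mu_ Lu hB; apply: (@ae_cvg_of_summable _ (B + 1)) => // k.
have md : measurable_fun T (fun x => `|u k.+1 x - u k x|).
  by apply: measurableT_comp => //; exact: measurable_funB.
have t0 : 0 < (2 : R) ^+ k by rewrite exprn_gt0.
have LS : Lr (fun x => 2 ^+ k * (u k.+1 x - u k x) ^+ 2 + (2 ^+ k)^-1).
  by apply: LrD (Lr_cst _); exact: LrZ.
have hle x : `|u k.+1 x - u k x| <= 2 ^+ k * (u k.+1 x - u k x) ^+ 2 + (2 ^+ k)^-1.
  exact: norm_AMGM.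
have Ln : Lr (fun x => `|u k.+1 x - u k x|).
  by apply: Lr_dom LS => // x; rewrite normr_id.
have h := le_Rintegral (@mTR R) Ln LS (fun x _ => hle x).
apply/(Rint_le_ereal _ (fun x => normr_ge0 _) Ln); apply: (le_trans h).
rewrite RintegralD//; [|exact: LrZ|exact: Lr_cst].
rewrite (@RintegralZl _ _ _ _ _ _ _ (@mTR R) (Lu k)) Rintegral_cst// [X in fine X]muT mulr1.
rewrite mulrDl mul1r exprVn lerD2r.
apply: (@le_trans _ _ (2 ^+ k * (B * 4^-1 ^+ k))); first by rewrite ler_pM2l.
rewrite exprVn (_ : (4 : R) = 2 * 2) ?exprMn; last by lra.
by rewrite invfM mulrCA mulrA mulrA mulfK ?gt_eqF.
Qed.

Variable n : nat.
Implicit Types (f g v p : vfun R n).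

(** The geometric rate makes the real and imaginary parts of each coordinate converge almost
    everywhere without extracting a subsequence. Fatou's lemma in [m] then transfers the bound, with
    the same rate, to the limit. *)
Lemma L2_complete (v : nat -> vfun R n) (B : R) : (forall k, L2v (v k)) ->
  (forall k m, (k <= m)%N -> nrm2 (lc (-1) (v m) (v k)) <= B * 4^-1 ^+ k) ->
  exists p, L2v p /\ forall k, nrm2 (lc (-1) p (v k)) <= B * 4^-1 ^+ k.
Proof.
move=> hv hB.
have hd k i : L2c (fun x => v k.+1 i x + -1 * v k i x) by exact: (L2v_lc (-1) (hv _) (hv _)).
have bd (F : C -> R) k i : (forall z, 0 <= F z <= cnorm2 z) ->
    measurable_fun T (fun x => F (v k.+1 i x + -1 * v k i x)) ->
    Lr (fun x => F (v k.+1 i x + -1 * v k i x)) /\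
    \int[mu]_(x in T) F (v k.+1 i x + -1 * v k i x) <= B * 4^-1 ^+ k.
  move=> hF mF; have LF : Lr (fun x => F (v k.+1 i x + -1 * v k i x)).
    apply: Lr_dom (L2c_int (hd k i)) => // x.
    by have /andP[a b] := hF (v k.+1 i x + -1 * v k i x); rewrite ger0_norm.
  split=> //; apply: le_trans (hB k k.+1 (leqnSn k)).
  rewrite nrm2E; apply: le_Rintegral => //; first exact: Lr_nrm2 (L2v_lc _ (hv _) (hv _)).
  move=> x _; rewrite (bigD1 i)//= -[leLHS]addr0 lerD//.
    by have /andP[] := hF (v k.+1 i x + -1 * v k i x).
  by apply: sumr_ge0 => j _; exact: cnorm2_ge0.
have cvR i : exists w : R -> R, measurable_fun T w /\
    aeT (fun x => Re (v k i x) @[k --> \oo] --> w x).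
  apply: (@ae_cvg_L2 (fun k x => Re (v k i x)) B) => k; first by case: (hv k i) => -[].
    have [] := bd (fun z => Re z ^+ 2) k i.
    + by move=> z; rewrite sqr_ge0 /cnorm2 lerDl sqr_ge0.
    + by apply: measurable_funX; case: (hd k i) => -[].
    + by under eq_fun do rewrite mulN1r cReD cReN.
  have [] := bd (fun z => Re z ^+ 2) k i.
  + by move=> z; rewrite sqr_ge0 /cnorm2 lerDl sqr_ge0.
  + by apply: measurable_funX; case: (hd k i) => -[].
  + by under eq_Rintegral do rewrite mulN1r cReD cReN.
have cvI i : exists w : R -> R, measurable_fun T w /\
    aeT (fun x => Im (v k i x) @[k --> \oo] --> w x).
  apply: (@ae_cvg_L2 (fun k x => Im (v k i x)) B) => k; first by case: (hv k i) => -[].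
    have [] := bd (fun z => Im z ^+ 2) k i.
    + by move=> z; rewrite sqr_ge0 /cnorm2 lerDr sqr_ge0.
    + by apply: measurable_funX; case: (hd k i) => -[].
    + by under eq_fun do rewrite mulN1r cImD cImN.
  have [] := bd (fun z => Im z ^+ 2) k i.
  + by move=> z; rewrite sqr_ge0 /cnorm2 lerDr sqr_ge0.
  + by apply: measurable_funX; case: (hd k i) => -[].
  + by under eq_Rintegral do rewrite mulN1r cImD cImN.
have [wR hR] := choice cvR; have [wI hI] := choice cvI.
pose p : vfun R n := fun i x => Complex (wR i x) (wI i x).
have pm i : cmeasurable (p i) by split; [exact: (hR i).1|exact: (hI i).1].
have dm k i : cmeasurable (lc (-1) p (v k) i).
  by apply: cmeasD => //; apply: cmeasM; [exact: cmeas_cst|exact: L2c_meas (hv k i)].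
have key k : (\int[mu]_(x in T) (\sum_i cnorm2 (lc (-1) p (v k) i x))%R%:E
    <= (B * 4^-1 ^+ k)%:E)%E.
  pose F m x := (\sum_i cnorm2 (lc (-1) (v m) (v k) i x))%:E : \bar R.
  have mF m : measurable_fun T (F m).
    apply/measurable_EFinP; apply: measurable_sum => i.
    by apply: meas_cnorm2; exact: L2c_meas (L2v_lc _ (hv _) (hv _) i).
  have mG : measurable_fun T (fun x => (\sum_i cnorm2 (lc (-1) p (v k) i x))%R%:E).
    by apply/measurable_EFinP; apply: measurable_sum => i; exact: meas_cnorm2.
  have F0 m x : T x -> (0 <= F m x)%E.
    by move=> _; rewrite lee_fin sumr_ge0// => i _; exact: cnorm2_ge0.
  have := fatou mu (@mTR R) mF F0.
  rewrite (_ : (\int[mu]_(x in T) _)%E = \int[mu]_(x in T) limn_einf (F ^~ x))%E.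
    move=> h; apply: le_trans h _; apply: (@limn_einf_le _ _ k) => m km.
    by have := hB k m km; rewrite -lee_fin -vnorm2E//; exact: L2v_lc.
  apply: ae_eq_integral => //.
  - rewrite (_ : (fun x => _) = (fun x => - limn_esup (fun m => - F m x))%E).
      apply: measurableT_comp => //; apply: measurable_fun_limn_esup => m.
      exact: (measurableT_comp _ (mF m)).
    by apply/funext => x; rewrite (limn_esupN (F ^~ x)) oppeK.
  - have := aeTS2 (fun x a b => conj a b) (aeT_all (fun i => (hR i).2)) (aeT_all (fun i => (hI i).2)).
    apply: (@filterS _ _ (ae_lebesgue_filter R)) => x h Tx; have [h1 h2] := h Tx.
    apply/esym; have -> := (@cvg_limn_einf_sup _ (F ^~ x) (\sum_i cnorm2 (lc (-1) p (v k) i x))%R%:E _).1 => //.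
    apply: cvg_EFin; first exact: nearW.
    apply: cvg_sumr => i; rewrite /lc.
    rewrite mulN1r.
    exact: cnorm2_cvg.
have hd0 i : L2c (lc (-1) p (v 0%N) i).
  split=> //; apply: le_lt_trans (le_lt_trans (key 0%N) (ltry _)).
  apply: ge0_le_integral => //.
  - by move=> x _; rewrite lee_fin cnorm2_ge0.
  - by apply/measurable_EFinP; exact: meas_cnorm2.
  - by apply/measurable_EFinP; apply: measurable_sum => j; exact: meas_cnorm2.
  - move=> x _; rewrite lee_fin (bigD1 i)//= lerDl.
    by apply: sumr_ge0 => j _; exact: cnorm2_ge0.
have hp : L2v p.
  move=> i; rewrite (_ : p i = fun x => lc (-1) p (v 0%N) i x + v 0%N i x).
    exact: (L2cD (hd0 i) (hv 0%N i)).
  by apply/funext => x; rewrite /lc mulN1r subrK.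
exists p; split=> // k; rewrite nrm2E.
apply/(Rint_le_ereal _ _ (Lr_nrm2 (L2v_lc (-1) hp (hv k)))) => [x|]; last exact: key.
by apply: sumr_ge0 => i _; exact: cnorm2_ge0.
Qed.


(* The minimising sequence [v k] is Cauchy because perturbing it along [v k - v m] cannot
   decrease the distance to [g] by more than [4^-k]. *)
Lemma projection (V : vfun R n -> Prop) g : L2v g -> (exists v, V v) ->
  (forall v, V v -> L2v v) -> (forall c v w, V v -> V w -> V (lc c v w)) ->
  exists p, [/\ L2v p, nearV V p & forall v, V v -> ip (lc (-1) g p) v = 0].
Proof.
move=> hg [v0 Vv0] hV Vlc.
pose E := [set nrm2 (lc (-1) g v) | v in V].
have hE : has_inf E.
  by split; [exists (nrm2 (lc (-1) g v0)), v0|exists 0 => _ [v _ <-]; exact: nrm2_ge0].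
set d := inf E.
have dle v : V v -> d <= nrm2 (lc (-1) g v).
  by move=> Vv; apply: ge_inf; [exact: hE.2|exists v].
have e0 k : 0 < (4^-1 : R) ^+ k by rewrite exprn_gt0.
have ex k : exists v, V v /\ nrm2 (lc (-1) g v) < d + 4^-1 ^+ k.
  by have [_ [v Vv <-] h] := inf_adherent (e0 k) hE; exists v.
have [v hv] := choice ex.
have vV k : V (v k) := (hv k).1.
have vL k : L2v (v k) := hV _ (vV k).
have aL k : L2v (lc (-1) g (v k)) by exact: L2v_lc.
have Cau k m : (k <= m)%N -> nrm2 (lc (-1) (v m) (v k)) <= 4 * 4^-1 ^+ k.
  move=> km; set w := lc (-1) (v m) (v k); set a := lc (-1) g (v m).
  have Vw : V w by exact: Vlc.
  have wL : L2v w := hV _ Vw.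
  have aL' : L2v a := aL m.
  have h1 : lc 1 a w = lc (-1) g (v k).
    by apply/funext => i; apply/funext => x; rewrite /lc /a /w /lc; ring.
  (* The point subtracted from [g] is the midpoint of [v m] and [v k], at squared distance at least
     [d] from [g]. Comparison with the two end points, as in the parallelogram law, produces the
     factor 4 of [Cau]. *)
  have h2 : lc (Complex 2^-1 0) a w = lc (-1) g (lc (- Complex 2^-1 0) (v m) w).
    by apply/funext => i; apply/funext => x; rewrite /lc /a /w /lc; ring.
  have h3 := dle _ (Vlc (- Complex 2^-1 0) _ _ (vV m) Vw).
  have ek : 4^-1 ^+ m <= (4^-1 : R) ^+ k.
    by rewrite ler_wiXn2l// invf_le1// ler1n.
  have := (hv k).2; have := (hv m).2; rewrite -/a -h1.
  move: h3; rewrite -h2 !nrm2_lc// mul1r cnorm21 /cnorm2 cReM /=.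
  lra.
have [p [pL hp]] := L2_complete vL Cau.
have np : nearV V p.
  move=> eps eps0; have [|k hk] := @expr_small 4^-1 4 eps _ eps0.
    by rewrite invr_ge0 invf_lt1// ltr1n ler0n.
  by exists (v k); split => //; exact: le_lt_trans (hp k) hk.
exists p; split=> // u Vu; have uL := hV _ Vu.
apply: cnorm2_eq0; apply/eqP; rewrite eq_le cnorm2_ge0 andbT.
have N0 := nrm2_ge0 u; set N := nrm2 u in N0 *.
(* The constant comes from g - p = (g - v k) - (p - v k) and |x + y|^2 <= 2|x|^2 + 2|y|^2, with [ha]
   and [hb] bounding the two terms. *)
apply: (@expr_le0 4^-1 (2 * (N + 1) + 8 * N)).
  by rewrite invr_ge0 invf_lt1// ltr1n ler0n.
move=> k; set a := lc (-1) g (v k); set b := lc (-1) p (v k).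
have bL : L2v b by exact: L2v_lc.
have aL' : L2v a := aL k.
have -> : lc (-1) g p = lc (-1) a b.
  by apply/funext => i; apply/funext => x; rewrite /lc /a /b /lc; ring.
rewrite ip_lcl//; apply: le_trans (cnorm2D _ _) _; rewrite cnorm2M cnorm2N cnorm21 mul1r.
have hb : cnorm2 (ip b u) <= 4 * 4^-1 ^+ k * N.
  have c1 := ip_CauchySchwarz bL uL; rewrite -/N in c1.
  have c2 := ler_wpM2r N0 (hp k); rewrite -/b in c2; lra.
suff ha : cnorm2 (ip a u) <= (N + 1) * 4^-1 ^+ k by lra.
(* Moving from [v k] along [u] must not bring the squared distance to [g] below [d]. The optimal
   step would be 1/N; [N + 1] covers N = 0 as well. *)
set P := cnorm2 _; set l := (N + 1)^-1.
have N1 : 0 < N + 1 by lra.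
have l0 : 0 < l by rewrite invr_gt0.
pose c := - (Complex l 0) * ip a u.
have h2 : lc c a u = lc (-1) g (lc (- c) (v k) u).
  by apply/funext => i; apply/funext => x; rewrite /lc /a /lc; ring.
have := dle _ (Vlc (- c) _ _ (vV k) Vu); rewrite -h2 nrm2_lc// /c.
rewrite (ip_conj (aL k) uL) cnorm2M cnorm2N -[X in complex.Re X]mulrA conjcE -/P -/N.
rewrite [cnorm2 (Complex _ _)]/cnorm2 cReM cReN cImN /=.
have := (hv k).2; rewrite -/a => q1 q2.
have P0 : 0 <= P := cnorm2_ge0 _.
have q3 : 2 * l * P <= 4^-1 ^+ k + l ^+ 2 * P * N by nra.
have q4 : l ^+ 2 * P * N <= l * P.
  rewrite (_ : l ^+ 2 * P * N = (l * P) * (l * N)); last by ring.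
  apply: ler_piMr; first by rewrite mulr_ge0// ltW.
  by rewrite /l mulrC ler_pdivrMr// mul1r; lra.
have q5 : l * P <= 4^-1 ^+ k by lra.
by rewrite -ler_pdivrMl// -/l.
Qed.

End Completeness.

(** * Uniqueness of Fourier coefficients *)

Section Fourier.
Variable R : realType.
Local Notation C := R[i].
Local Notation mu := (@lebesgue_measure R).
Local Notation Re := complex.Re.
Local Notation Im := complex.Im.
Local Notation T := (@Tset R).
Let mT_ : measurable T := @mT R.
Hint Resolve mT_ : core.
Let mTR_ := @mTR R.
Hint Resolve mTR_ : core.
Implicit Types (phi u g : cfun R) (s t x : R).

(** These are the polynomials of the Brosowski-Deutsch proof of the Stone-Weierstrass theorem. On
    [0,1] they stay between 0 and 1 and tend to 1 for s < 1/2 and to 0 for s > 1/2, so composing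
    them with a trigonometric polynomial yields bounded approximations of the indicator of an
    arc. *)
Definition qpol (m : nat) s : R := (1 - s ^+ m) ^+ (2 ^ m).

Lemma bernoulli_le (y : R) (N : nat) : 0 <= y <= 1 -> 1 - N%:R * y <= (1 - y) ^+ N.
Proof.
move=> /andP[y0 y1]; elim: N => [|N ih]; first by rewrite mul0r subr0 expr0.
rewrite exprS -natr1; have := ler_wpM2l _ ih; move=> /(_ (1 - y)); rewrite subr_ge0 => /(_ y1).
apply: le_trans; have : 0 <= N%:R * y ^+ 2 by rewrite mulr_ge0// exprn_ge0.
nra.
Qed.

Lemma bernoulli_ge (y : R) (N : nat) : 0 <= y -> 1 + N%:R * y <= (1 + y) ^+ N.
Proof.
move=> y0; elim: N => [|N ih]; first by rewrite mul0r addr0 expr0.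
rewrite exprS -natr1; have := ler_wpM2l _ ih; move=> /(_ (1 + y)); rewrite addr_ge0// => /(_ isT).
apply: le_trans; have : 0 <= N%:R * y ^+ 2 by rewrite mulr_ge0// exprn_ge0.
nra.
Qed.

Lemma qpol_ge0 m s : 0 <= s <= 1 -> 0 <= qpol m s <= 1.
Proof.
move=> /andP[s0 s1]; have h : 0 <= s ^+ m <= 1 by rewrite exprn_ge0// exprn_ile1.
rewrite /qpol exprn_ge0 ?exprn_ile1//; lra.
Qed.

Lemma qpol_cvg1 s : 0 <= s -> s < 2^-1 -> qpol m s @[m --> \oo] --> (1 : R).
Proof.
move=> s0 s1.
have h0 m : 0 <= s ^+ m <= 1 by rewrite exprn_ge0// exprn_ile1//; lra.
apply: (@squeeze_cvgr _ _ _ _ (fun m => 1 - (2 * s) ^+ m) (fun=> 1)).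
- have hs : 0 <= s <= 1 by lra.
  apply: nearW => m; have /andP[_ ->] := qpol_ge0 m hs; rewrite andbT.
  by rewrite exprMn -natrX; exact: bernoulli_le.
- rewrite -[X in _ --> X]subr0; apply: cvgB; first exact: cvg_cst.
  by apply: cvg_expr; rewrite ger0_norm; lra.
- exact: cvg_cst.
Qed.

(** The product of [qpol m s] and (1 + s^m)^(2^m) is (1 - s^(2m))^(2^m), at most 1, while
    Bernoulli's inequality bounds the second factor below by (2s)^m. *)
Lemma qpol_cvg0 s : 2^-1 < s -> s <= 1 -> qpol m s @[m --> \oo] --> (0 : R).
Proof.
move=> s0 s1; have sp : 0 < s by lra.
apply: (@squeeze_cvgr _ _ _ _ (fun=> 0) (fun m => ((2 * s)^-1) ^+ m)).
- have hs : 0 <= s <= 1 by lra.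
  apply: nearW => m; have /andP[q0 _] := qpol_ge0 m hs; rewrite q0 /=.
  have y0 : 0 < s ^+ m by rewrite exprn_gt0.
  have y1 : s ^+ m <= 1 by rewrite exprn_ile1// ltW.
  have h1 := @bernoulli_ge (s ^+ m) (2 ^ m) (ltW y0).
  have h2 : qpol m s * (1 + s ^+ m) ^+ (2 ^ m) <= 1.
    rewrite /qpol -exprMn exprn_ile1//; nra.
  have h3 : qpol m s * (2 * s) ^+ m <= 1.
    apply: le_trans h2; apply: ler_wpM2l => //.
    by apply: le_trans h1; rewrite exprMn -natrX lerDr.
  by rewrite exprVn -[leRHS]mul1r ler_pdivlMr// exprn_gt0// mulr_gt0.
- exact: cvg_cst.
- by apply: cvg_expr; rewrite ger0_norm ?invr_ge0 ?invf_lt1; lra.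
Qed.

Lemma L1c_bddM u phi (B : R) : cmeasurable u -> (forall x, cnorm2 (u x) <= B) ->
  L1c phi -> L1c (fun x => u x * phi x).
Proof.
move=> mu_ hB hp; have [m1 m2] := cmeasM mu_ (L1c_meas hp); have [p1 p2] := hp.
have hS : Lr (fun x => (1 + B) * `|Re (phi x)| + (1 + B) * `|Im (phi x)|).
  by apply: LrD; apply: LrZ; exact: integrable_norm.
have bR x : `|Re (u x)| <= 1 + B.
  by apply: le_trans (normRe_le _) _; rewrite lerD2l.
have bI x : `|Im (u x)| <= 1 + B.
  have := hB x; rewrite /cnorm2 ler_norml => h; apply/andP; split; nra.
split.
- apply: Lr_dom m1 _ hS => x; rewrite cReM (le_trans (ler_normB _ _))// !normrM.
  by rewrite lerD// ler_wpM2r.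
- apply: Lr_dom m2 _ hS => x; rewrite cImM (le_trans (ler_normD _ _))// !normrM addrC.
  by rewrite lerD// ler_wpM2r.
Qed.

Definition coef0 phi := L1c phi /\ forall k : int, cint (fun x => phi x * zpow k x) = 0.

Lemma L1c_zpowM (k : int) phi : L1c phi -> L1c (fun x => phi x * zpow k x).
Proof.
move=> h; under [X in L1c X]eq_fun do rewrite mulrC.
by apply: (@L1c_bddM _ _ 1) => //; [exact: zpow_meas|move=> x; rewrite cnorm2_zpow].
Qed.

(** Multiplication by [g] preserves the vanishing of all Fourier coefficients. These multipliers
    form an algebra containing the trigonometric monomials, so the polynomials [qpol] of a
    trigonometric polynomial need not be expanded. *)
Definition coef0_mult g := [/\ cmeasurable g, exists B, forall x, cnorm2 (g x) <= B &
  forall phi, coef0 phi -> coef0 (fun x => g x * phi x)].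

Lemma coef0_multZ (c : C) : coef0_mult (fun=> c).
Proof.
split; [exact: cmeas_cst|by exists (cnorm2 c)|].
move=> phi [h1 h2]; split; first exact: L1cZ.
move=> k; under [X in cint X]eq_fun do rewrite -mulrA.
by rewrite cintZ ?h2 ?mulr0//; exact: L1c_zpowM.
Qed.
Lemma coef0_mult_zpow (l : int) : coef0_mult (@zpow R l).
Proof.
split; [exact: zpow_meas|by exists 1 => x; rewrite cnorm2_zpow|].
move=> phi [h1 h2]; split.
  by under [X in L1c X]eq_fun do rewrite mulrC; exact: L1c_zpowM.
move=> k; rewrite -(h2 (l + k)); congr cint; apply/funext => x.
by rewrite zpowD; ring.
Qed.
Lemma coef0_multD u g : coef0_mult u -> coef0_mult g -> coef0_mult (fun x => u x + g x).
Proof.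
move=> [m1 [B1 b1] h1] [m2 [B2 b2] h2]; split; first exact: cmeasD.
  exists (2 * B1 + 2 * B2) => x; apply: le_trans (cnorm2D _ _) _.
  by rewrite lerD// ler_pM2l.
move=> phi hp; have [a1 c1] := h1 _ hp; have [a2 c2] := h2 _ hp; split.
  by under [X in L1c X]eq_fun do rewrite mulrDl; exact: L1cD.
move=> k; under [X in cint X]eq_fun do rewrite mulrDl mulrDl.
by rewrite cintD ?c1 ?c2 ?addr0//; exact: L1c_zpowM.
Qed.
Lemma coef0_multM u g : coef0_mult u -> coef0_mult g -> coef0_mult (fun x => u x * g x).
Proof.
move=> [m1 [B1 b1] h1] [m2 [B2 b2] h2]; split; first exact: cmeasM.
  exists (B1 * B2) => x; rewrite cnorm2M.
  by apply: ler_pM; rewrite ?cnorm2_ge0.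
by move=> phi hp; under [X in coef0 X]eq_fun do rewrite -mulrA; exact/h1/h2.
Qed.
Lemma coef0_multX u (m : nat) : coef0_mult u -> coef0_mult (fun x => u x ^+ m).
Proof.
move=> h; elim: m => [|m ih]; first exact: coef0_multZ.
by under [X in coef0_mult X]eq_fun do rewrite exprS; exact: coef0_multM.
Qed.

Definition rmult (s : R -> R) := coef0_mult (fun x => (s x)%:C%C).

Lemma rmult_qpol (s : R -> R) m : rmult s -> rmult (fun x => qpol m (s x)).
Proof.
move=> h; rewrite /rmult.
rewrite (_ : (fun x => _) = fun x => (1 + -1 * (s x)%:C%C ^+ m) ^+ (2 ^ m)); last first.
  by apply/funext => x; rewrite /qpol rmorphXn rmorphB rmorph1 rmorphXn mulN1r.
apply: coef0_multX; apply: coef0_multD; first exact: coef0_multZ.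
by apply: coef0_multM; [exact: coef0_multZ|exact: coef0_multX].
Qed.

Lemma rmult_trig (a b c : R) : rmult (fun x => a + b * cos (2 * pi * x) + c * sin (2 * pi * x)).
Proof.
rewrite /rmult (_ : (fun x => _) = fun x => Complex a 0 + (Complex (b / 2) (- (c / 2)) * zpow 1 x +
   Complex (b / 2) (c / 2) * zpow (-1) x)); last first.
  apply/funext => x; rewrite /zpow mulr1 mulrN1 mulNr cosN sinN.
  by apply: complexP; rewrite !ReImE /=; field.
by do 2?[apply: coef0_multD]; try apply: coef0_multM;
  try exact: coef0_multZ; exact: coef0_mult_zpow.
Qed.

Lemma rmult_int (s : R -> R) phi : rmult s -> coef0 phi ->
  \int[mu]_(x in T) (s x * Re (phi x)) = 0 /\ \int[mu]_(x in T) (s x * Im (phi x)) = 0.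
Proof.
move=> [_ _ h] /h[h1 /(_ 0)]; rewrite /cint => -[e1 e2].
split; [rewrite -[RHS]e1|rewrite -[RHS]e2]; apply: eq_Rintegral => x _.
- by rewrite zpow0 mulr1 cReM /= mul0r subr0.
- by rewrite zpow0 mulr1 cImM /= mul0r addr0.
Qed.

Lemma rmult_dom (psi : R -> R) (Q : nat -> R -> R) (A : set R) : measurable A ->
  Lr psi -> (forall m, measurable_fun T (Q m)) -> (forall m x, `|Q m x| <= 1) ->
  aeT (fun x => Q m x @[m --> \oo] --> (\1_A x : R)) ->
  (forall m, \int[mu]_(x in T) (Q m x * psi x) = 0) ->
  \int[mu]_(x in T) (\1_A x * psi x) = 0.
Proof.
move=> mA hp mQ bQ cQ iQ.
have LQ m : Lr (fun x => Q m x * psi x).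
  apply: Lr_dom (integrable_norm hp); first by apply: measurable_funM => //; exact: Lr_meas.
  by move=> x; rewrite normrM ler_piMl.
have := @dominated_convergence _ _ _ mu T (@mTR R) (fun m x => (Q m x * psi x)%:E)
  (fun x => (\1_A x * psi x)%:E) (fun x => `|psi x|%:E).
case.
- by move=> m; apply/measurable_EFinP; exact: Lr_meas (LQ m).
- apply/measurable_EFinP; apply: measurable_funM; last exact: Lr_meas.
  exact: measurable_indic.
- apply: (@filterS _ _ (ae_lebesgue_filter R)) cQ => x h Tx.
  by apply: cvg_EFin; [exact: nearW|apply: cvgM; [exact: h|exact: cvg_cst]].
- exact: integrable_norm.
- by apply: aeW => x m Tx; rewrite /= lee_fin normrM ler_piMl.
move=> _ _ h.
rewrite /Rintegral.
have : (fun m => \int[mu]_(x in T) (Q m x * psi x)%:E)%E @ \oo --> (0%:E : \bar R).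
  rewrite (_ : (fun _ => _) = fun=> 0%:E); first exact: cvg_cst.
  apply/funext => m; rewrite -(iQ m) /Rintegral fineK//.
  by apply: integrable_fin_num => //; exact: LQ.
by move=> /(cvg_unique _ h) ->.
Qed.

Lemma aeT_neq (c : R) : aeT (fun x => x <> c).
Proof.
exists [set c]; split; [exact: measurable_set1|exact: lebesgue_measure_set1|].
by move=> x /= h; apply: contrapT => xc; apply: h.
Qed.

Lemma rmult_meas (s : R -> R) : rmult s -> measurable_fun T s.
Proof. by case=> -[]. Qed.

Lemma rmultM (s1 s2 : R -> R) : rmult s1 -> rmult s2 -> rmult (fun x => s1 x * s2 x).
Proof.
move=> h1 h2; rewrite /rmult; under [X in coef0_mult X]eq_fun do rewrite rmorphM.
exact: coef0_multM.
Qed.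

Lemma sin2pi_gt0 (y : R) : 0 < y < 2^-1 -> 0 < sin (2 * pi * y).
Proof.
move=> /andP[y0 y1]; apply: sin_gt0_pi; have := pi_gt0 R => p0.
by apply/andP; split; nra.
Qed.

Lemma sin2pi_lt0 (y : R) : - 2^-1 < y < 0 -> sin (2 * pi * y) < 0.
Proof.
move=> /andP[y0 y1]; have := @sin2pi_gt0 (- y); rewrite mulrN sinN => h.
by rewrite -oppr_gt0; apply: h; lra.
Qed.

Lemma half_sin (y : R) : 0 <= (1 - sin y) / 2 <= 1.
Proof. by have := sin_le1 y; have := sin_geN1 y; lra. Qed.

(** The arc from h to x, of length at most 1/2, is the intersection of the half circle starting at h
    with the half circle ending at x, and each of them is the positivity set of a sine. The sign [e]
    makes e sin(2 pi t) positive on the first one: e = 1 for h = 0 and e = -1 for h = 1/2. *)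
Lemma arc_int0 (h e : R) (psi : R -> R) : Lr psi ->
  (forall s : R -> R, rmult s -> \int[mu]_(x in T) (s x * psi x) = 0) ->
  e ^+ 2 = 1 ->
  (forall t, 0 < t < 1 -> t <> 2^-1 -> (h < t < h + 2^-1 -> 0 < e * sin (2 * pi * t)) /\
     (~~ (h < t < h + 2^-1) -> e * sin (2 * pi * t) < 0)) ->
  forall x, h < x <= h + 2^-1 -> \int[mu]_(t in T) (\1_(`]h, x[%classic) t * psi t) = 0.
Proof.
move=> Lp hp e2 he x /andP[hx xh].
(* [s1] is below 1/2 exactly where the first sine is positive, and [s2] exactly where the second one
   is; these are the thresholds of [qpol]. *)
pose s1 t : R := (1 - e * sin (2 * pi * t)) / 2.
pose s2 t : R := (1 - sin (2 * pi * (x - t))) / 2.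
have r1 : rmult s1.
  rewrite (_ : s1 = fun t => 2^-1 + 0 * cos (2 * pi * t) + - (e / 2) * sin (2 * pi * t)).
    exact: rmult_trig.
  by apply/funext => t; rewrite /s1; field.
have r2 : rmult s2.
  rewrite (_ : s2 = fun t => 2^-1 + - (sin (2 * pi * x) / 2) * cos (2 * pi * t) +
     cos (2 * pi * x) / 2 * sin (2 * pi * t)).
    exact: rmult_trig.
  by apply/funext => t; rewrite /s2 mulrBr sinB; field.
have b1 t : 0 <= s1 t <= 1.
  have := sin_le1 (2 * pi * t); have := sin_geN1 (2 * pi * t); rewrite /s1.
  by move/eqP: e2; rewrite sqrf_eq1 => /orP[/eqP->|/eqP->]; lra.
have b2 t : 0 <= s2 t <= 1 := half_sin _.
have rQ m := rmultM (rmult_qpol m r1) (rmult_qpol m r2).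
have q1 m t := qpol_ge0 m (b1 t); have q2 m t := qpol_ge0 m (b2 t).
apply: (@rmult_dom psi (fun m t => qpol m (s1 t) * qpol m (s2 t))) => //.
- by move=> m; exact: rmult_meas.
- move=> m t; have /andP[? ?] := q1 m t; have /andP[? ?] := q2 m t.
  by rewrite ger0_norm ?mulr_ge0//; exact: mulr_ile1.
(* The points left out are the ends of the half circles and x, where [s1] or [s2] equals 1/2 and
   [qpol] tends neither to 0 nor to 1. *)
- have hn : aeT (fun t => [/\ 0 < t < 1, t <> 2^-1 & t <> x]).
    have := aeTS2 (fun _ a b => conj a b)
      (aeTS2 (fun _ a b => conj a b) (aeT_neq 0) (aeT_neq 1))
      (aeTS2 (fun _ a b => conj a b) (aeT_neq 2^-1) (aeT_neq x)).
    apply: (@filterS _ _ (ae_lebesgue_filter R)) => t k Tt; have [[k0 k1] [k2 k3]] := k Tt.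
    split=> //; move: Tt; rewrite /Tset /= in_itv /= => /andP[t0 t1].
    by rewrite !lt_neqAle t0 t1 !andbT; apply/andP; split; apply/eqP => // /esym.
  apply: aeTS hn => t [t01 th tx]; have [hin hout] := he t t01 th.
  rewrite indicE.
  have [tH|tH] := boolP (h < t < h + 2^-1); last first.
    rewrite memNset; last first.
      by rewrite /= in_itv /= => /andP[a b]; move/negP: tH; apply; rewrite a; lra.
    have s1t : 2^-1 < s1 t by have := hout tH; rewrite /s1; lra.
    have /andP[_ s1t'] := b1 t.
    apply: (@squeeze_cvgr _ _ _ _ (fun=> 0) (fun m => qpol m (s1 t))).
    + apply: nearW => m; have /andP[? ?] := q1 m t; have /andP[? ?] := q2 m t.
      by rewrite mulr_ge0//=; exact: ler_piMr.
    + exact: cvg_cst.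
    + exact: qpol_cvg0.
  have s1t : s1 t < 2^-1 by have := hin tH; rewrite /s1; lra.
  have /andP[ht th2] := tH.
  have [tltx|xltt|/tx//] := ltgtP t x.
  + rewrite mem_set /=; last by rewrite in_itv /= ht tltx.
    have hs : 0 < sin (2 * pi * (x - t)) by apply: sin2pi_gt0; lra.
    have s2t : s2 t < 2^-1 by rewrite /s2; lra.
    have /andP[s1t' _] := b1 t; have /andP[s2t' _] := b2 t.
    by rewrite -[X in _ --> X]mulr1; apply: cvgM; exact: qpol_cvg1.
  + rewrite memNset /=; last by rewrite in_itv /= => /andP[_ tx']; lra.
    have hs : sin (2 * pi * (x - t)) < 0 by apply: sin2pi_lt0; lra.
    have s2t : 2^-1 < s2 t by rewrite /s2; lra.
    have /andP[_ s2t'] := b2 t.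
    apply: (@squeeze_cvgr _ _ _ _ (fun=> 0) (fun m => qpol m (s2 t))).
    + apply: nearW => m; have /andP[? ?] := q1 m t; have /andP[? ?] := q2 m t.
      by rewrite mulr_ge0//=; exact: ler_piMl.
    + exact: cvg_cst.
    + exact: qpol_cvg0.
- by move=> m; exact: hp.
Qed.

(** The primitive of [psi], cut off outside the arc, vanishes identically; by Lebesgue's
    differentiation theorem its derivative is almost everywhere the cut-off function itself. *)
Lemma arc_ae0 (h : R) (psi : R -> R) : Lr psi -> 0 <= h -> h + 2^-1 <= 1 ->
  (forall x, h < x <= h + 2^-1 -> \int[mu]_(t in T) (\1_(`]h, x[%classic) t * psi t) = 0) ->
  aeT (fun x => h < x < h + 2^-1 -> psi x = 0).
Proof.
move=> Lp h0 h1 hz; set H := `]h, h + 2^-1[%classic : set R.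
have mH : @measurable _ (measurableTypeR R) H by exact: measurable_itv.
have HT : H `<=` T.
  by move=> x; rewrite /H /Tset /= !in_itv /= => /andP[a b]; lra.
have iH : mu.-integrable H (EFin \o psi) by exact: integrableS Lp.
have iHT : mu.-integrable setT (EFin \o (psi \_ H)).
  rewrite (_ : EFin \o _ = (EFin \o psi) \_ H); last first.
    by apply/funext => x; rewrite /= !patchE; case: ifP.
  by apply/(integrable_mkcond _ mH).
have := @FTC1Ny R (psi \_ H).
move=> /(_ _ (integrable_locally mH iH)) hF.
have iy y : mu.-integrable `]-oo, y] (EFin \o (psi \_ H)).
  by apply: integrableS iHT => //; exact: measurable_itv.
have {}hF := hF iy.
apply: (@filterS _ _ (ae_lebesgue_filter R)) hF => x /= [_ e] Tx xH.
rewrite -[LHS](_ : (psi \_ H) x = _); last by rewrite patchE mem_set//= in_itv.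
rewrite -e (_ : (fun y => _) = fun=> 0) ?derive1_cst//.
apply/funext => y.
have key z : h < z <= h + 2^-1 -> \int[mu]_(t in `]h, z[%classic) psi t = 0.
  move=> hzz; rewrite -(hz z hzz) Rintegral_mkcond [RHS]Rintegral_mkcond.
  apply: eq_Rintegral => t _; rewrite !patchE indicE.
  have [tz|tz] := boolP (t \in `]h, z[%classic).
    rewrite mem_set; first by rewrite mul1r.
    apply: HT; move: tz; rewrite inE /H /= !in_itv /= => /andP[-> tz].
    by move: hzz => /andP[_ ?]; lra.
  by rewrite mul0r; case: ifP.
rewrite -Rintegral_mkcondr.
have [yh|hy] := leP y h.
  rewrite (_ : _ `&` _ = set0) ?Rintegral_set0//.
  by apply/seteqP; split=> // t; rewrite /H /= !in_itv /= => -[a /andP[b _]]; lra.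
have [yh2|hy2] := ltP y (h + 2^-1).
  rewrite (_ : _ `&` _ = `]h, y]%classic); last first.
    apply/seteqP; split=> t; rewrite /H /= !in_itv /=.
      by move=> [-> /andP[->]].
    by move=> /andP[-> ty]; split=> //; rewrite (le_lt_trans ty).
  rewrite -Rintegral_itv_bndo_bndc; first by apply: key; rewrite hy ltW.
  apply: integrableS iH => //.
  by move=> t; rewrite /H /= !in_itv /= => /andP[-> /ltW/le_lt_trans/(_ yh2)].
rewrite (_ : _ `&` _ = H).
  by apply: key; lra.
apply/seteqP; split=> [t []//|t tH]; split=> //; move: tH; rewrite /H /= !in_itv /=.
by move=> /andP[_ ?]; lra.
Qed.

(** The real and imaginary parts are treated separately on the two half circles, on which sin(2 pi
    t) has a constant sign; only 0, 1/2 and 1 are left over. Integrability is all that is assumed,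
    since the statement is applied to pointwise inner products of L^2 vectors. *)
Lemma fourier_unique phi : coef0 phi -> aeT (fun x => phi x = 0).
Proof.
move=> hphi; have [[LR LI] _] := hphi.
suff main (psi : R -> R) : Lr psi ->
    (forall s : R -> R, rmult s -> \int[mu]_(x in T) (s x * psi x) = 0) -> aeT (fun x => psi x = 0).
  have eR := main _ LR (fun (s : R -> R) hs => (rmult_int hs hphi).1).
  have eI := main _ LI (fun (s : R -> R) hs => (rmult_int hs hphi).2).
  by apply: aeTS2 eR eI => x a b; exact: complexP.
move=> Lp hp.
have sgn t : 0 < t < 1 -> t <> 2^-1 ->
    (t < 2^-1 -> 0 < sin (2 * pi * t)) /\ (2^-1 < t -> sin (2 * pi * t) < 0).
  move=> /andP[t0 t1] t2; split=> t3; first by apply: sin2pi_gt0; rewrite t0.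
  have := @sin2pi_lt0 (t - 1); rewrite mulrBr mulr1 mulr_natl sinB.
  rewrite cos2pi sin2pi mulr1 mulr0 subr0; apply; lra.
have A1 : aeT (fun x => 0 < x < 0 + 2^-1 -> psi x = 0).
  apply: arc_ae0 => //; first by lra.
  apply: (@arc_int0 0 1) => //; first by rewrite expr1n.
  move=> t t01 t2; have [s1 s2] := sgn t t01 t2; rewrite mul1r add0r; split.
    by move=> /andP[_]; exact: s1.
  move=> k; apply: s2; rewrite lt_neqAle; apply/andP; split; first by apply/eqP => /esym.
  rewrite leNgt; apply: contra k => k; rewrite k andbT; by case/andP: t01.
have A2 : aeT (fun x => 2^-1 < x < 2^-1 + 2^-1 -> psi x = 0).
  apply: arc_ae0 => //; try by lra.
  apply: (@arc_int0 2^-1 (-1)) => //; first by rewrite sqrrN expr1n.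
  move=> t t01 t2; have [s1 s2] := sgn t t01 t2; rewrite mulN1r; split.
    by move=> /andP[/s2]; rewrite oppr_gt0.
  move=> k; rewrite oppr_lt0; apply: s1; rewrite lt_neqAle; apply/andP; split; first exact/eqP.
  by rewrite leNgt; apply: contra k => k; rewrite k /=; lra.
have hn := aeTS2 (fun _ a b => conj a b) (aeTS2 (fun _ a b => conj a b) (aeT_neq 0) (aeT_neq 1))
  (aeT_neq 2^-1).
have hA := aeTS2 (fun _ a b => conj a b) A1 A2.
have := aeTS2 (fun _ a b => conj a b) hn hA.
apply: (@filterS _ _ (ae_lebesgue_filter R)) => t k Tt.
have [[[n0 n1] n2] [a1 a2]] := k Tt.
move: Tt; rewrite /Tset /= in_itv /= => /andP[t0 t1].
have [lt|gt|/n2//] := ltgtP t 2^-1.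
- apply: a1; rewrite add0r lt andbT lt_neqAle t0 andbT; apply/eqP => /esym; exact: n0.
- apply: a2; rewrite gt /= (_ : 2^-1 + 2^-1 = 1); last by lra.
  by rewrite lt_neqAle t1 andbT; apply/eqP; exact: n1.
Qed.

End Fourier.

(** * Products of Hardy functions *)

Section Hardy.
Variable R : realType.
Local Notation C := R[i].
Local Notation mu := (@lebesgue_measure R).
Implicit Types (f g u v b : cfun R).

Lemma H2c_L2 f : H2c f -> L2c f. Proof. by case. Qed.

Lemma L1_coef f (k : int) : L2c f -> L1c (fun x => f x * zpow k x).
Proof. by move=> h; apply: L1c_zpowM; exact: L2c_L1. Qed.

Lemma posz_add_neq0 (j k : nat) : (j%:Z + k.+1%:Z)%R != 0.
Proof. by rewrite -PoszD addnS. Qed.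

Lemma H2cD f g : H2c f -> H2c g -> H2c (fun x => f x + g x).
Proof.
move=> [f1 f2] [g1 g2]; split; first exact: L2cD.
move=> k; under [X in cint X]eq_fun do rewrite mulrDl.
by rewrite cintD ?f2 ?g2 ?addr0//; exact: L1_coef.
Qed.
Lemma H2cZ (c : C) f : H2c f -> H2c (fun x => c * f x).
Proof.
move=> [f1 f2]; split; first exact: L2cZ.
move=> k; under [X in cint X]eq_fun do rewrite -mulrA.
by rewrite cintZ ?f2 ?mulr0//; exact: L1_coef.
Qed.
Lemma H2c_zpow (k : nat) : H2c (@zpow R k).
Proof.
split; first exact: L2c_zpow.
move=> j; rewrite -(cint_zpow R (posz_add_neq0 k j)); congr cint; apply/funext => x.
by rewrite zpowD.
Qed.
Lemma H2c_cst (c : C) : H2c (fun _ : R => c).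
Proof.
have := H2cZ c (H2c_zpow 0%N); congr H2c; apply/funext => x.
by rewrite zpow0 mulr1.
Qed.
Lemma H2c_sum I (r : seq I) (p : pred I) (F : I -> cfun R) :
  (forall i, p i -> H2c (F i)) -> H2c (fun x => \sum_(i <- r | p i) F i x).
Proof.
move=> h; elim: r => [|i r ih].
  rewrite (_ : (fun _ => _) = fun=> 0); first exact: H2c_cst.
  by apply/funext => x; rewrite big_nil.
rewrite (_ : (fun _ => _) = fun x => if p i then F i x + \sum_(j <- r | p j) F j x else
   \sum_(j <- r | p j) F j x); last by apply/funext => x; rewrite big_cons.
by case E: (p i) => //; apply: H2cD => //; exact: h.
Qed.
Lemma H2c_ext f g : H2c f -> L2c g -> aeT (fun x => f x = g x) -> H2c g.
Proof.
move=> [f1 f2] hg e; split=> // k; rewrite -(f2 k); apply: cint_ae.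
- by apply: L1c_meas; exact: L1_coef.
- by apply: L1c_meas; exact: L1_coef.
- by apply: aeTS e => x ->.
Qed.

(* [u] is projected onto the bi-annihilator of the analytic monomials; the difference has
   no nonzero Fourier coefficient. *)
Lemma H2c_biannihilator u g : H2c u -> L2c g ->
  (forall j : nat, cint (fun x => zpow j x * conjc (g x)) = 0) ->
  cint (fun x => u x * conjc (g x)) = 0.
Proof.
move=> [uL u2] hg hj.
pose vec f : vfun R 1 := fun=> f.
have ipE f f' : ip (vec f) (vec f') = cint (fun x => f x * conjc (f' x)).
  by congr cint; apply/funext => x; rewrite big_ord1.
have vecE (w : vfun R 1) : w = vec (w ord0).
  by apply/funext => i; rewrite (ord1 i).
pose V (w : vfun R 1) := L2v w /\ forall h : vfun R 1, L2v h ->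
  (forall j : nat, ip (vec (@zpow R j)) h = 0) -> ip w h = 0.
have Vz (j : nat) : V (vec (@zpow R j)).
  by split=> [i|h _ /(_ j)//]; exact: L2c_zpow.
have [p [pL np hp]] : exists p, [/\ L2v p, nearV V p & forall w, V w ->
    ip (lc (-1) (vec u) p) w = 0].
  apply: projection => //.
  - by exists (vec (zpow 0%N)); exact: Vz.
  - by move=> w [].
  - move=> c v' w [vL hv] [wL hw]; split; first exact: L2v_lc.
    by move=> h hL hh; rewrite ip_lcl// hv// hw// mulr0 addr0.
have uvL : L2v (vec u) by [].
have Vp h : L2v h -> (forall j : nat, ip (vec (@zpow R j)) h = 0) -> ip p h = 0.
  move=> hL hh; apply: (nearV_orth (V := V)) => // w [wL hw]; split=> //; exact: hw.
(* The negative monomials are orthogonal to all analytic ones, hence to [p]; so [p], like [u], has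
   no negative coefficient. On the other indices [p] and [u] agree because [p] is a projection onto
   a space containing the analytic monomials. *)
have p2 (k : nat) : ip p (vec (@zpow R (- (k.+1)%:Z))) = 0.
  apply: Vp; first by move=> i; exact: L2c_zpow.
  move=> j; rewrite ipE -(cint_zpow R (posz_add_neq0 j k)); congr cint; apply/funext => x.
  by rewrite zpow_conj opprK zpowD.
set d := lc (-1) (vec u) p in hp.
have dL : L2v d by exact: L2v_lc.
have d0 : aeT (fun x => d ord0 x = 0).
  apply: fourier_unique; split; first exact/L2c_L1/dL.
  case=> [[|k]|k].
  - have := hp _ (Vz 0%N); rewrite (vecE d) ipE => <-; congr cint; apply/funext => x.
    by rewrite zpow0 conjc1.
  - have : ip d (vec (@zpow R (- k.+1%:Z))) = 0.
      rewrite /d ip_lcl//; last by move=> i; exact: L2c_zpow.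
      rewrite p2 mulr0 addr0 ipE -[RHS](u2 k); congr cint; apply/funext => x.
      by rewrite zpow_conj opprK.
    rewrite (vecE d) ipE => <-; congr cint; apply/funext => x.
    by rewrite zpow_conj opprK.
  - have := hp _ (Vz k.+1); rewrite (vecE d) ipE => <-; congr cint; apply/funext => x.
    by rewrite zpow_conj NegzE.
transitivity (ip p (vec g)); last by apply: Vp => // j; rewrite ipE.
rewrite -ipE; apply: ip_ext => //; last exact: aeTW.
apply: aeTS d0 => x e i; rewrite (ord1 i).
by move/eqP: e; rewrite /d /lc mulN1r subr_eq0 => /eqP.
Qed.

(** The conjugate of v z^(k+1) is orthogonal to every z^j with j >= 0, because v is in H^2. By
    [H2c_biannihilator] it is then orthogonal to u as well. *)
Lemma H2c_mul_int u v (k : nat) : H2c u -> H2c v ->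
  cint (fun x => u x * v x * zpow k.+1 x) = 0.
Proof.
move=> hu [vL hv].
have := @H2c_biannihilator u (fun x => conjc (v x * zpow k.+1 x)) hu.
have -> : (fun x => u x * conjc (conjc (v x * zpow k.+1 x))) = fun x => u x * v x * zpow k.+1 x.
  by apply/funext => x; rewrite conjcK mulrA.
apply.
  apply: L2c_conj; under [X in L2c X]eq_fun do rewrite mulrC.
  exact: L2c_zpowM.
move=> j; rewrite -(hv (j + k)%N); congr cint; apply/funext => x.
by rewrite conjcK mulrCA -zpowD -PoszD addnS.
Qed.

Lemma Hinf_bdd b : Hinf b -> exists M, aeT (fun x => cnorm2 (b x) <= M).
Proof. by case. Qed.
Lemma Hinf_meas b : Hinf b -> cmeasurable b.
Proof. by case=> -[/L2c_meas]. Qed.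
Lemma Hinf_H2 b : Hinf b -> H2c b. Proof. by case. Qed.
Lemma HinfM_L2 b f : Hinf b -> L2c f -> L2c (fun x => b x * f x).
Proof. by move=> hb hf; have [M hM] := Hinf_bdd hb; exact: (L2c_bddM (Hinf_meas hb) hM hf). Qed.
Lemma HinfM_H2 b u : Hinf b -> H2c u -> H2c (fun x => b x * u x).
Proof.
move=> hb hu; split; first exact: HinfM_L2 (H2c_L2 hu).
by move=> k; apply: H2c_mul_int => //; exact: Hinf_H2.
Qed.
Lemma HinfM a b : Hinf a -> Hinf b -> Hinf (fun x => a x * b x).
Proof.
move=> ha hb; split; first exact: HinfM_H2 (Hinf_H2 hb).
have [M hM] := Hinf_bdd ha; have [N hN] := Hinf_bdd hb; exists (M * N).
by apply: aeTS2 hM hN => x h1 h2; rewrite cnorm2M ler_pM// cnorm2_ge0.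
Qed.
Lemma HinfD a b : Hinf a -> Hinf b -> Hinf (fun x => a x + b x).
Proof.
move=> ha hb; split; first exact: H2cD (Hinf_H2 ha) (Hinf_H2 hb).
have [M hM] := Hinf_bdd ha; have [N hN] := Hinf_bdd hb; exists (2 * M + 2 * N).
apply: aeTS2 hM hN => x h1 h2; apply: le_trans (cnorm2D _ _) _.
by rewrite lerD// ler_pM2l.
Qed.
Lemma Hinf_cst (c : C) : Hinf (fun _ : R => c).
Proof. by split; [exact: H2c_cst|exists (cnorm2 c); exact: aeTW]. Qed.
Lemma Hinf_zpow (k : nat) : Hinf (@zpow R k).
Proof. by split; [exact: H2c_zpow|exists 1; apply: aeTW => x; rewrite cnorm2_zpow]. Qed.
Lemma Hinf_sum I (r : seq I) (p : pred I) (F : I -> cfun R) :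
  (forall i, p i -> Hinf (F i)) -> Hinf (fun x => \sum_(i <- r | p i) F i x).
Proof.
move=> h; elim: r => [|i r ih].
  rewrite (_ : (fun _ => _) = fun=> 0); first exact: Hinf_cst.
  by apply/funext => x; rewrite big_nil.
rewrite (_ : (fun _ => _) = fun x => if p i then F i x + \sum_(j <- r | p j) F j x else
   \sum_(j <- r | p j) F j x); last by apply/funext => x; rewrite big_cons.
by case E: (p i) => //; apply: HinfD => //; exact: h.
Qed.
Lemma Hinf_prod I (r : seq I) (F : I -> cfun R) :
  (forall i, Hinf (F i)) -> Hinf (fun x => \prod_(i <- r) F i x).
Proof.
move=> h; elim: r => [|i r ih].
  rewrite (_ : (fun _ => _) = fun=> 1); first exact: Hinf_cst.
  by apply/funext => x; rewrite big_nil.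
under [X in Hinf X]eq_fun do rewrite big_cons.
exact: HinfM.
Qed.
Lemma Hinf_det k (A : 'I_k -> 'I_k -> cfun R) : (forall i j, Hinf (A i j)) ->
  Hinf (fun x => \det (\matrix_(i, j) A i j x)).
Proof.
move=> h; rewrite (_ : (fun x => _) = fun x => \sum_(s : 'S_k)
    (-1) ^+ s * \prod_i A i (s i) x); last first.
  apply/funext => x; apply: eq_bigr => s _; congr (_ * _).
  by apply: eq_bigr => i _; rewrite mxE.
apply: Hinf_sum => s _; apply: HinfM; first exact: Hinf_cst.
by apply: Hinf_prod.
Qed.

End Hardy.

(** * The Beurling-Lax theorem *)

Section BeurlingLax.
Variable R : realType.
Local Notation C := R[i].
Local Notation mu := (@lebesgue_measure R).
Local Notation Re := complex.Re.
Variables (n : nat) (Psi : vfun R n -> Prop).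
Hypothesis PsiL : forall psi, Psi psi -> L2v psi.
Hypothesis PsiS : forall psi, Psi psi -> Psi (smul (zpow (-1)) psi).
Implicit Types (f g h m v w p : vfun R n).

(** Describing the subspace by test vectors builds in what the Beurling-Lax theorem requires: it is
    closed by [nearV_orth], and z-invariant because [Psi] is stable under multiplication by 1/z. *)
Definition annih h := H2v h /\ forall psi, Psi psi -> ip h psi = 0.
Definition wandering w := annih w /\ forall m, annih m -> ip w (smul (zpow 1) m) = 0.
Definition mcol k (Th : mxfun R n k) (j : 'I_k) : vfun R n := fun i => Th i j.

Lemma H2v_L2 f : H2v f -> L2v f. Proof. by move=> h i; exact: H2c_L2. Qed.
Lemma H2v_lc c f g : H2v f -> H2v g -> H2v (lc c f g).
Proof. by move=> hf hg i; apply: H2cD => //; exact: H2cZ. Qed.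
Lemma annih_L2 h : annih h -> L2v h. Proof. by case=> /H2v_L2. Qed.
Lemma annih_lc c f g : annih f -> annih g -> annih (lc c f g).
Proof.
move=> [f1 f2] [g1 g2]; split; first exact: H2v_lc.
move=> psi hpsi; rewrite ip_lcl ?f2 ?g2 ?mulr0 ?addr0//; try exact: H2v_L2.
exact: PsiL.
Qed.
Lemma smulD (k l : int) f : smul (zpow k) (smul (zpow l) f) = smul (zpow (k + l)) f.
Proof. by apply/funext => i; apply/funext => x; rewrite /smul zpowD mulrA. Qed.
Lemma smul0 f : smul (zpow 0) f = f.
Proof. by apply/funext => i; apply/funext => x; rewrite /smul zpow0 mul1r. Qed.
Lemma smul_lc (k : int) c f g :
  smul (zpow k) (lc c f g) = lc c (smul (zpow k) f) (smul (zpow k) g).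
Proof. by apply/funext => i; apply/funext => x; rewrite /smul /lc; ring. Qed.
Lemma nrm2_smul (k : int) f : nrm2 (smul (zpow k) f) = nrm2 f.
Proof. by rewrite /nrm2 ip_zpow smulD addNr smul0. Qed.
Lemma annih_shift (k : nat) h : annih h -> annih (smul (zpow k) h).
Proof.
move=> [h1 h2]; split.
  by move=> i; apply: HinfM_H2; [exact: Hinf_zpow|exact: h1].
move=> psi hpsi; rewrite ip_zpow h2//; elim: k => [|k ih]; first by rewrite oppr0 smul0.
by rewrite -[k.+1]addn1 PoszD opprD addrC -smulD; exact: PsiS.
Qed.

(** Pairing with [ecol k i0] reads the Fourier coefficient of index -(k+1) of the coordinate [i0].
    Membership in H^2 thus becomes an orthogonality condition and passes to limits. *)
Definition ecol (k : nat) (i0 : 'I_n) : vfun R n :=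
  fun i x => if i == i0 then zpow (- k.+1%:Z) x else 0.
Lemma ecol_L2 k i0 : L2v (ecol k i0).
Proof.
move=> i; rewrite /ecol; case: (i == i0); [exact: L2c_zpow|exact: L2c_cst].
Qed.
Lemma ip_ecol k i0 f : ip f (ecol k i0) = cint (fun x => f i0 x * zpow k.+1 x).
Proof.
congr cint; apply/funext => x; rewrite (bigD1 i0)//= big1 => [|i ii0].
  by rewrite /ecol eqxx addr0 zpow_conj opprK.
by rewrite /ecol (negbTE ii0) conjc0 mulr0.
Qed.

Lemma annih_closed p : L2v p -> nearV annih p -> annih p.
Proof.
move=> pL np; split.
  move=> i; split=> // k; rewrite -ip_ecol; apply: (nearV_orth (V := annih)) => //.
    exact: ecol_L2.
  move=> v hv; split; first exact: annih_L2.
  by rewrite ip_ecol; case: hv => /(_ i)[_ ->].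
move=> psi hpsi; apply: (nearV_orth (V := annih)) => //; first exact: PsiL.
by move=> v hv; split; [exact: annih_L2|apply: hv.2].
Qed.
Lemma annih_ext f g : annih f -> L2v g -> aeT (fun x => forall i, f i x = g i x) -> annih g.
Proof.
move=> hf gL e; apply: annih_closed => // eps e0; exists f; split=> //.
rewrite (_ : nrm2 _ = 0)// /nrm2 ip_eq0//; try (by apply: L2v_lc => //; exact: annih_L2).
by apply: aeTS e => x e i; rewrite /lc e mulN1r subrr.
Qed.

(* [ip w (z^k w') = 0] for [k <> 0], so the pointwise product has only a constant Fourier term. *)
Lemma wandering_const w w' : wandering w -> wandering w' ->
  aeT (fun x => \sum_i w i x * conjc (w' i x) = ip w w').
Proof.
move=> [wM hw] [wM' hw']; have wL := annih_L2 wM; have wL' := annih_L2 wM'.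
have z0 (v v' : vfun R n) (k : nat) : wandering v -> annih v' -> ip v (smul (zpow k.+1) v') = 0.
  move=> [_ hv] hv'; rewrite -[k.+1]add1n PoszD -smulD; apply: hv; exact: annih_shift.
set phi := fun x => \sum_i w i x * conjc (w' i x).
have Lphi : L1c phi := ip_L1 wL wL'.
have cphi (k : int) : cint (fun x => phi x * zpow k x) = ip w (smul (zpow (- k)) w').
  congr cint; apply/funext => x; rewrite mulr_suml; apply: eq_bigr => i _.
  by rewrite /smul conjcM zpow_conj opprK; ring.
have Lc : L1c (fun x => phi x + - ip w w') by apply: L1cD => //; exact/L2c_L1/L2c_cst.
suff : aeT (fun x => phi x + - ip w w' = 0).
  by apply: aeTS => x /eqP; rewrite subr_eq0 => /eqP.
apply: fourier_unique; split=> // k.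
under [X in cint X]eq_fun do rewrite mulrDl.
rewrite cintD; [|exact: L1c_zpowM|by apply: L1_coef; exact: L2c_cst].
rewrite cphi cintZ; last exact/L2c_L1/L2c_zpow.
have [->|k0] := eqVneq k 0.
  rewrite oppr0 smul0 (_ : cint _ = 1) ?mulr1 ?subrr// -[RHS]cint_cst; congr cint.
  by apply/funext => x; rewrite zpow0.
rewrite (cint_zpow R k0) mulr0 addr0.
case: k k0 => [[|k]//|k] _.
- have := z0 w' w k (conj wM' hw') wM; rewrite (ip_conj (L2v_zpow _ wL)) ?ip_zpow//.
  by move=> /(congr1 conjc); rewrite conjcK conjc0.
- by rewrite NegzE opprK; exact: z0.
Qed.

Definition orthonormal_wandering k (e : 'I_k -> vfun R n) :=
  (forall j, wandering (e j)) /\ forall j j', ip (e j) (e j') = (j == j')%:R.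

Lemma orthonormal_ae k (e : 'I_k -> vfun R n) : orthonormal_wandering e ->
  aeT (fun x => forall j j', \sum_i e j i x * conjc (e j' i x) = (j == j')%:R).
Proof.
move=> [h1 h2]; apply: aeT_all => j; apply: aeT_all => j'; rewrite -h2.
exact: wandering_const.
Qed.

(** At almost every point the values of the [k] vectors are orthonormal in C^n, and a single such
    point suffices. *)
Lemma orthonormal_bound k (e : 'I_k -> vfun R n) : orthonormal_wandering e -> (k <= n)%N.
Proof.
move=> /orthonormal_ae h; apply: contrapT => kn; apply: (@aeT_false R).
apply: aeTS h => x h; apply: kn.
pose A := \matrix_(j < k, i < n) e j i x; pose B := \matrix_(i < n, j < k) conjc (e j i x).
apply: (@mulmx1_min _ _ _ A B); apply/matrixP => j j'; rewrite !mxE -h.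
by apply: eq_bigr => i _; rewrite !mxE.
Qed.

Lemma exists_max_orthonormal : exists k (e : 'I_k -> vfun R n), orthonormal_wandering e /\
  forall k' (e' : 'I_k' -> vfun R n), orthonormal_wandering e' -> (k' <= k)%N.
Proof.
pose P k := `[< exists e : 'I_k -> vfun R n, orthonormal_wandering e >].
have P0 : exists k, P k.
  exists 0%N; apply/asboolP; exists (fun=> fun=> fun=> 0).
  by split=> -[].
have Pn k : P k -> (k <= n)%N by move=> /asboolP[e]; exact: orthonormal_bound.
have [k /asboolP[e he] hm] := ex_maxnP P0 Pn.
by exists k, e; split=> // k' e' he'; apply: hm; apply/asboolP; exists e'.
Qed.

Lemma wandering_lc c v w : wandering v -> wandering w -> wandering (lc c v w).
Proof.
move=> [v1 v2] [w1 w2]; split; first exact: annih_lc.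
move=> m hm; rewrite ip_lcl ?v2 ?w2 ?mulr0 ?addr0//; try exact: annih_L2.
by apply: annih_L2; exact: annih_shift.
Qed.

Lemma max_orthonormal_complete k (e : 'I_k -> vfun R n) : orthonormal_wandering e ->
  (forall k' (e' : 'I_k' -> vfun R n), orthonormal_wandering e' -> (k' <= k)%N) ->
  forall w, wandering w -> (forall j, ip w (e j) = 0) -> nullv w.
Proof.
move=> [eW eO] hmax w wW we; have wL := annih_L2 wW.1.
have eL j : L2v (e j) := annih_L2 (eW j).1.
apply: nrm2_eq0 => //; apply: contrapT => N0.
have Np : 0 < nrm2 w by rewrite lt_neqAle nrm2_ge0 andbT eq_sym; apply/eqP.
set r := Num.sqrt (nrm2 w).
have r0 : 0 < r by rewrite sqrtr_gt0.
pose c : C := Complex r^-1 0.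
(* This is c w, the normalisation of [w], written with [lc] so that [wandering_lc] applies. *)
pose w' := lc (c - 1) w w.
have w'W : wandering w' by exact: wandering_lc.
have w'L := annih_L2 w'W.1.
have w'e j : ip w' (e j) = 0 by rewrite ip_lcl// we mulr0 addr0.
have w'1 : ip w' w' = 1.
  rewrite ip_lcl// !ip_lcr// !ipff -(sqr_sqrtr (ltW Np)) -/r.
  by apply: complexP; rewrite !ReImE /=; field; rewrite gt_eqF.
pose e' (j : 'I_k.+1) := if unlift ord_max j is Some j' then e j' else w'.
have /hmax : orthonormal_wandering e'.
  split; first by move=> j; rewrite /e'; case: unliftP.
  move=> j j'; rewrite /e'; case: (unliftP ord_max j) => [a ->|->];
    case: (unliftP ord_max j') => [b ->|->].
  - by rewrite eO (inj_eq lift_inj).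
  - by rewrite (ip_conj w'L (eL a)) w'e conjc0 eq_sym (negbTE (neq_lift _ _)).
  - by rewrite w'e (negbTE (neq_lift _ _)).
  - by rewrite eqxx.
by rewrite ltnn.
Qed.

(* [m - P m], with [P] the projection onto [z annih], is wandering and orthogonal to the
   maximal family, hence null; iterating, [m] is divisible by every power of [z]. *)
Theorem Beurling_Lax : exists k (Th : mxfun R n k),
  [/\ inner Th, forall j, annih (mcol Th j) &
      forall m, annih m -> (forall j (l : nat), ip m (smul (zpow l) (mcol Th j)) = 0) -> nullv m].
Proof.
have [k [e [he hmax]]] := exists_max_orthonormal.
have eae := orthonormal_ae he; have [eW eO] := he.
have eL j : L2v (e j) := annih_L2 (eW j).1.
exists k, (fun i j => e j i); split.
- split.
    move=> i j; split; first exact: (eW j).1.1.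
    exists 1; apply: aeTS eae => x /(_ j j); rewrite eqxx => /(congr1 (@complex.Re R)).
    rewrite Re_sum => h; rewrite -[leRHS]h (bigD1 i)//= conjcE /= lerDl.
    by apply: sumr_ge0 => i' _; rewrite conjcE /= cnorm2_ge0.
  apply: aeTS eae => x h j j'; rewrite eq_sym -h; apply: eq_bigr => i _.
  by rewrite mulrC.
- by move=> j; exact: (eW j).1.
move=> m mM mort.
have div1 v : annih v -> (forall j, ip v (e j) = 0) -> annih (smul (zpow (-1)) v).
  move=> vM ve; have vL := annih_L2 vM.
  (* This is z [annih], expressed through division by z so that no preimage has to be chosen. *)
  pose V w := annih (smul (zpow (-1)) w) /\ L2v w.
  have zV w : annih w -> V (smul (zpow 1) w).
    by move=> wM; split; [rewrite smulD addNr smul0|exact/L2v_zpow/annih_L2].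
  have VM w : V w -> annih w.
    by move=> [w1 _]; have := annih_shift 1 w1; rewrite smulD addrN smul0.
  have [p [pL np hp]] : exists p, [/\ L2v p, nearV V p & forall w, V w -> ip (lc (-1) v p) w = 0].
    apply: projection => //.
    - by exists (smul (zpow 1) v); exact: zV.
    - by move=> w [].
    - move=> c w w' [w1 w2] [w1' w2']; split; last exact: L2v_lc.
      by rewrite smul_lc; exact: annih_lc.
  have pV : V p.
    split=> //; apply: annih_closed; first exact: L2v_zpow.
    move=> eps e0; have [w [[wM wL] hw]] := np eps e0.
    by exists (smul (zpow (-1)) w); split=> //; rewrite -smul_lc nrm2_smul.
  have dM : annih (lc (-1) v p) by apply: annih_lc => //; exact: VM.
  have dW : wandering (lc (-1) v p) by split=> // w wM; apply: hp; exact: zV.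
  have d0 : nullv (lc (-1) v p).
    apply: (max_orthonormal_complete he hmax) => // j.
    rewrite ip_lcl// ve add0r (_ : ip p (e j) = 0) ?mulr0//.
    rewrite (ip_conj (eL j) pL).
    rewrite (_ : p = smul (zpow 1) (smul (zpow (-1)) p)); last by rewrite smulD addrN smul0.
    by rewrite ((eW j).2 _ pV.1) conjc0.
  apply: (annih_ext pV.1); first exact: L2v_zpow.
  by apply: aeTS d0 => x d0 i; move: (d0 i); rewrite /lc mulN1r /smul => /eqP;
    rewrite subr_eq0 => /eqP ->.
have divl (l : nat) : annih (smul (zpow (- l%:Z)) m).
  elim: l => [|l ih]; first by rewrite oppr0 smul0.
  rewrite -[l.+1]add1n PoszD opprD -smulD; apply: div1 => // j.
  by rewrite ip_zpow opprK; exact: mort.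
have mH : H2v m := mM.1.
apply: aeT_all => i; apply: fourier_unique; split; first exact/L2c_L1/H2c_L2.
(* The coefficient of index l of m is the coefficient of index -1 of z^(-(l+1)) m, which lies in
   H^2. *)
have neg (l : nat) : cint (fun x => m i x * zpow (- l%:Z) x) = 0.
  have [/(_ i)[_ /(_ 0%N) h] _] := divl l.+1.
  rewrite -[RHS]h; congr cint; apply/funext => x.
  rewrite /smul (_ : zpow (- l%:Z) x = zpow (- l.+1%:Z) x * zpow 1 x); first by ring.
  by rewrite -zpowD; congr (zpow _ _); rewrite -[l.+1]addn1 PoszD opprD addrNK.
case=> [[|l]|l]; first exact: (neg 0%N).
- by have [_ /(_ l)] := mH i.
- by rewrite NegzE; exact: neg.
Qed.

End BeurlingLax.

(** * The range of an inner function *)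

Section BeurlingLaxConsequences.
Variable R : realType.
Local Notation C := R[i].
Local Notation mu := (@lebesgue_measure R).
Local Notation T := (@Tset R).

Lemma H2c_shift_coef (Phi : cfun R) : L2c Phi ->
  (forall k : nat, cint (fun x => Phi x * zpow k x) = 0) -> H2c (fun x => zpow (-1) x * Phi x).
Proof.
move=> hL h; split; first exact: L2c_zpowM.
move=> k; rewrite -[RHS](h k); congr cint; apply/funext => x.
by rewrite -[k.+1]add1n PoszD zpowD mulrA [X in X * _]mulrAC zpowNK mul1r.
Qed.

(** The hypothesis puts Phi in z H^2. Writing Phi = z Phi' with Phi' in H^2, the integral is the
    coefficient of index -1 of h Phi'. *)
Lemma H2c_coef_int0 (h Phi : cfun R) : H2c h -> L2c Phi ->
  (forall k : nat, cint (fun x => Phi x * zpow k x) = 0) -> cint (fun x => h x * Phi x) = 0.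
Proof.
move=> hh hL hP; rewrite -[RHS](H2c_mul_int 0%N hh (H2c_shift_coef hL hP)).
congr cint; apply/funext => x.
by rewrite -[LHS]mul1r -(zpowNK 1 x); ring.
Qed.

Variables (n : nat) (Psi : vfun R n -> Prop).
Hypothesis PsiL : forall psi, Psi psi -> L2v psi.
Hypothesis PsiS : forall psi, Psi psi -> Psi (smul (zpow (-1)) psi).

Section Range.
Variables (k : nat) (Th : mxfun R n k).
Hypothesis Thi : inner Th.
Hypothesis ThM : forall j, annih Psi (mcol Th j).

Let ThH i j : Hinf (Th i j) := Thi.1 i j.

Lemma symbol_L2 psi j : L2v psi -> L2c (fun x => \sum_i Th i j x * conjc (psi i x)).
Proof. by move=> hp; apply: L2c_sum => i _; apply: HinfM_L2 => //; exact: L2c_conj. Qed.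

(** Column j times z^l stays in the annihilator. Pairing with [psi] therefore shows that entry j of
    the row psi^* Theta has no coefficient of nonpositive index, that is, lies in z H^2. *)
Lemma symbol_coef psi j (l : nat) : Psi psi ->
  cint (fun x => (\sum_i Th i j x * conjc (psi i x)) * zpow l x) = 0.
Proof.
move=> hp; have [_ /(_ _ hp) h] := annih_shift PsiS l (ThM j).
rewrite -[RHS]h; congr cint; apply/funext => x.
by rewrite mulr_suml; apply: eq_bigr => i _; rewrite /smul /mcol; ring.
Qed.

Lemma mapply_H2 (h : vfun R k) : H2v h -> H2v (mapply Th h).
Proof. by move=> hh i; apply: H2c_sum => j _; exact: HinfM_H2. Qed.

Lemma mapply_L2 (h : vfun R k) : L2v h -> L2v (mapply Th h).
Proof. by move=> hh i; apply: L2c_sum => j _; exact: HinfM_L2. Qed.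

Lemma annih_mapply (h : vfun R k) : H2v h -> annih Psi (mapply Th h).
Proof.
move=> hh; split; first exact: mapply_H2.
move=> psi hp; have hpL := PsiL hp.
transitivity (cint (fun x => \sum_j h j x * \sum_i Th i j x * conjc (psi i x))).
  congr cint; apply/funext => x.
  under eq_bigr do rewrite /mapply mulr_suml.
  rewrite exchange_big; apply: eq_bigr => j _; rewrite mulr_sumr.
  by apply: eq_bigr => i _; ring.
rewrite cint_sum => [|j _]; last first.
  by apply: L1cM; [exact: H2c_L2|exact: symbol_L2].
rewrite big1// => j _; apply: H2c_coef_int0 => //; first exact: symbol_L2.
by move=> l; exact: symbol_coef.
Qed.

Definition adj_apply (m : vfun R n) : vfun R k := fun j x => \sum_i conjc (Th i j x) * m i x.

Lemma adj_apply_L2 m : L2v m -> L2v (adj_apply m).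
Proof.
move=> hm j; apply: L2c_sum => i _; have [M hM] := Hinf_bdd (ThH i j).
apply: (@L2c_bddM _ _ _ M) => //; first exact/cmeas_conj/Hinf_meas.
by apply: aeTS hM => x; rewrite cnorm2_conj.
Qed.

Lemma adj_apply_mapply x (h : vfun R k) :
  (forall j j' : 'I_k, \sum_i conjc (Th i j x) * Th i j' x = (j == j')%:R) ->
  forall j, adj_apply (mapply Th h) j x = h j x.
Proof.
move=> hx j; rewrite /adj_apply /mapply.
under eq_bigr do rewrite mulr_sumr.
rewrite exchange_big; transitivity (\sum_j' (j == j')%:R * h j' x).
  apply: eq_bigr => j' _; rewrite -hx mulr_suml.
  by apply: eq_bigr => i _; rewrite mulrA.
rewrite (bigD1 j)//= eqxx mul1r big1 ?addr0// => j' jj'.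
by rewrite eq_sym (negbTE jj') mul0r.
Qed.

Lemma ip_mapply_res (h : vfun R k) m : L2v h -> L2v m ->
  ip (mapply Th h) (lc (-1) m (mapply Th (adj_apply m))) = 0.
Proof.
move=> hh hm; have hr : L2v (lc (-1) m (mapply Th (adj_apply m))).
  by apply: L2v_lc => //; apply: mapply_L2; exact: adj_apply_L2.
rewrite -(cint0 R); apply: cint_ae.
- by apply: L1c_meas; apply: ip_L1 => //; exact: mapply_L2.
- exact: cmeas_cst.
apply: aeTS Thi.2 => x hx.
set r := lc _ _ _.
transitivity (\sum_j h j x * conjc (adj_apply r j x)).
  under eq_bigr do rewrite /mapply mulr_suml.
  rewrite exchange_big; apply: eq_bigr => j _.
  rewrite /adj_apply conjc_sum mulr_sumr; apply: eq_bigr => i _.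
  by rewrite conjcM conjcK; ring.
rewrite big1// => j _; rewrite (_ : adj_apply r j x = 0) ?conjc0 ?mulr0//.
rewrite (_ : adj_apply r j x = adj_apply m j x - adj_apply (mapply Th (adj_apply m)) j x).
  by rewrite adj_apply_mapply// subrr.
rewrite {1}/adj_apply /r /lc; under eq_bigr do rewrite mulrDr mulN1r mulrN.
by rewrite big_split /= sumrN.
Qed.

Definition delta_zpow (l : nat) (j : 'I_k) : vfun R k :=
  fun j' x => if j' == j then zpow l x else 0.

Lemma delta_zpow_H2 l j : H2v (delta_zpow l j).
Proof.
by move=> j'; rewrite /delta_zpow; case: (j' == j); [exact: H2c_zpow|exact: H2c_cst].
Qed.

Lemma smul_mcol (l : nat) j : smul (zpow l) (mcol Th j) = mapply Th (delta_zpow l j).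
Proof.
apply/funext => i; apply/funext => x.
rewrite /smul /mcol /mapply /delta_zpow (bigD1 j)//= eqxx.
by rewrite big1 ?addr0 1?mulrC// => j' /negbTE ->; rewrite mulr0.
Qed.

(** By completeness [m] agrees almost everywhere with its projection onto the closure of Theta H^2.
    The residue r = m - Theta Theta^* m is orthogonal to Theta L^2, hence to that closure and to m,
    and so to itself. The coefficients Theta^* m are only obtained in L^2; neither their analyticity
    nor the closedness of Theta H^2 enters. *)
Lemma annih_range m :
  (forall m, annih Psi m -> (forall j (l : nat), ip m (smul (zpow l) (mcol Th j)) = 0) -> nullv m) ->
  annih Psi m -> aeT (fun x => forall i, m i x = mapply Th (adj_apply m) i x).
Proof.
move=> complete mM; have mL := annih_L2 mM.
pose V (w : vfun R n) := exists h : vfun R k, H2v h /\ w = mapply Th h.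
have VM w : V w -> annih Psi w by move=> [h [hh ->]]; exact: annih_mapply.
have VL w : V w -> L2v w by move=> /VM/annih_L2.
have [p [pL np hp]] : exists p, [/\ L2v p, nearV V p & forall w, V w -> ip (lc (-1) m p) w = 0].
  apply: projection => //.
  - by exists (mapply Th (fun _ _ => 0)), (fun _ _ => 0); split=> // i; exact: H2c_cst.
  - move=> c _ _ [h [hh ->]] [h' [hh' ->]]; exists (lc c h h'); split; first exact: H2v_lc.
    apply/funext => i; apply/funext => x; rewrite /lc /mapply mulr_sumr -big_split /=.
    by apply: eq_bigr => j _; ring.
have pM : annih Psi p.
  apply: annih_closed => // eps e0; have [w [Vw hw]] := np eps e0.
  by exists w; split=> //; exact: VM.
have d0 : nullv (lc (-1) m p).
  apply: complete; first exact: annih_lc.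
  move=> j l; apply: hp; exists (delta_zpow l j); split; first exact: delta_zpow_H2.
  exact: smul_mcol.
set r := lc (-1) m (mapply Th (adj_apply m)).
have aL := adj_apply_L2 mL.
have rL : L2v r by apply: L2v_lc => //; exact: mapply_L2.
have pr : ip p r = 0.
  apply: (nearV_orth (V := V)) => // w [h [hh ->]].
  by split; [exact/mapply_L2/H2v_L2|apply: ip_mapply_res => //; exact: H2v_L2].
have mr : ip m r = 0.
  rewrite -pr; apply: ip_ext => //; last exact: aeTW.
  by apply: aeTS d0 => x d0 i; move/eqP: (d0 i); rewrite /lc mulN1r subr_eq0 => /eqP.
have : nullv r.
  apply: nrm2_eq0 => //; rewrite /nrm2 {1}/r ip_lcl//; last exact: mapply_L2.
  by rewrite mr ip_mapply_res// mulr0 addr0.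
by apply: aeTS => x h i; move/eqP: (h i); rewrite /r /lc mulN1r subr_eq0 => /eqP.
Qed.

End Range.
End BeurlingLaxConsequences.

(** * Hardy functions as quotients, and their zero sets *)

Section QuotientField.
Variable R : realType.
Local Notation C := R[i].
Local Notation mu := (@lebesgue_measure R).
Local Notation T := (@Tset R).

(** Without columns, the completeness clause of [Beurling_Lax] would make every element of the
    annihilator null. So there is a first column, and it has pointwise norm 1. *)
Lemma nonzero_annih_col n (Psi : vfun R n -> Prop) :
  (forall psi, Psi psi -> L2v psi) -> (forall psi, Psi psi -> Psi (smul (zpow (-1)) psi)) ->
  (exists m, annih Psi m /\ ~ nullv m) ->
  exists w : vfun R n, [/\ annih Psi w, forall i, Hinf (w i) &
    aeT (fun x => \sum_i conjc (w i x) * w i x = 1)].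
Proof.
move=> PsiL PsiS [m [mM m0]].
have [[|k] [Th [Thi ThM comp]]] := Beurling_Lax PsiL PsiS.
  by case: m0; apply: comp => // -[].
exists (mcol Th ord0); split; [exact: ThM|by move=> i; exact: Thi.1|].
by apply: aeTS Thi.2 => x /(_ ord0 ord0).
Qed.

(* The graph [{(a, a f)}] is a closed invariant subspace; its inner column is [(a, a f)]
   with both entries bounded. *)
Lemma H2c_Nev (f : cfun R) : H2c f -> Nev f.
Proof.
move=> fH; have fL := H2c_L2 fH.
(* Pairing m with [pk k] gives a Fourier coefficient of m_1 - m_0 f. As k runs through all integers,
   uniqueness turns annihilation into the graph equation m_1 = m_0 f. *)
pose pk (k : int) : vfun R 2 := fun i x => if i == ord0 then - conjc (f x) * zpow k x else zpow k x.
pose Psi (psi : vfun R 2) := exists k, psi = pk k.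
have o1 : (lift ord0 ord0 : 'I_2) == ord0 = false by [].
have PsiL psi : Psi psi -> L2v psi.
  move=> [k ->] i; rewrite /pk; case: (i == ord0); last exact: L2c_zpow.
  under [X in L2c X]eq_fun do rewrite mulrC -mulN1r.
  by apply: L2c_zpowM; apply: L2cZ; exact: L2c_conj.
have PsiS psi : Psi psi -> Psi (smul (zpow (-1)) psi).
  move=> [k ->]; exists (-1 + k); apply/funext => i; apply/funext => x.
  by rewrite /smul /pk zpowD; case: (i == ord0) => //; ring.
have ipk (m : vfun R 2) k : ip m (pk k) =
    cint (fun x => (m (lift ord0 ord0) x - m ord0 x * f x) * zpow (- k) x).
  congr cint; apply/funext => x; rewrite big_ord_recl big_ord1 /pk eqxx o1.
  by rewrite conjcM conjcN conjcK zpow_conj; ring.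
have graph (m : vfun R 2) : annih Psi m -> aeT (fun x => m (lift ord0 ord0) x = m ord0 x * f x).
  move=> [mH hm]; have mL := H2v_L2 mH.
  suff : aeT (fun x => m (lift ord0 ord0) x - m ord0 x * f x = 0).
    by apply: aeTS => x /eqP; rewrite subr_eq0 => /eqP.
  apply: fourier_unique; split.
    under [X in L1c X]eq_fun do rewrite -mulN1r.
    by apply: L1cD; [exact: L2c_L1|apply: L1cZ; exact: L1cM].
  by move=> k; rewrite -[RHS](hm (pk (- k))); [rewrite ipk opprK|exists (- k)].
have [w [wM wH w1]] : exists w : vfun R 2, [/\ annih Psi w, forall i, Hinf (w i) &
    aeT (fun x => \sum_i conjc (w i x) * w i x = 1)].
  apply: nonzero_annih_col => //; exists (fun i x => if i == ord0 then 1 else f x); split.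
    split; first by move=> i; case: (i == ord0); [exact: H2c_cst|].
    move=> _ [k ->]; rewrite ipk /= -(cint0 R); congr cint; apply/funext => x.
    by rewrite mul1r subrr mul0r.
  move=> h; apply: (@aeT_false R); apply: aeTS h => x /(_ ord0) /eqP.
  by rewrite oner_eq0.
exists (w (lift ord0 ord0)), (w ord0); split => //.
- move=> w0; apply: (@aeT_false R).
  apply: aeTS2 (aeTS2 (fun _ a b => conj a b) (graph _ wM) w0) w1 => x [g h].
  rewrite big_ord_recl big_ord1 g h mul0r !mulr0 addr0 => /eqP.
  by rewrite eq_sym oner_eq0.
- by apply: aeTS (graph _ wM) => x ->; rewrite mulrC.
Qed.

(* The functions vanishing on the zero set of [u] form a closed invariant subspace, which
   contains a unimodular function as soon as it is nonzero. *)
Lemma H2c_neq0 (u : cfun R) : H2c u -> ~ aeT (fun x => u x = 0) -> aeT (fun x => u x <> 0).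
Proof.
move=> uH u0; have uL := H2c_L2 uH.
pose Z := T `&` (fun x => cnorm2 (u x)) @^-1` [set 0].
have mZ : @measurable _ (measurableTypeR R) Z.
  by apply: (meas_cnorm2 (L2c_meas uL)) => //; exact: mT.
pose chi : cfun R := fun x => Complex (\1_Z x) 0.
have chiL : L2c chi.
  apply: (@L2c_bdd _ _ 1).
    split; last exact: measurable_cst.
    by apply: measurable_indic.
  apply: aeTW => x; rewrite /cnorm2 /chi /= indicE expr0n addr0.
  by case: (_ \in _); rewrite ?expr1n ?expr0n.
have chi_conj x : conjc (chi x) = chi x by apply: complexP; rewrite /chi /= ?oppr0.
pose pk (k : int) : vfun R 1 := fun _ x => zpow k x * chi x.
pose Psi (psi : vfun R 1) := exists k, psi = pk k.
have PsiL psi : Psi psi -> L2v psi by move=> [k ->] i; exact: L2c_zpowM.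
have PsiS psi : Psi psi -> Psi (smul (zpow (-1)) psi).
  move=> [k ->]; exists (-1 + k); apply/funext => i; apply/funext => x.
  by rewrite /smul /pk zpowD mulrA.
have ipk (m : vfun R 1) k : ip m (pk k) = cint (fun x => m ord0 x * chi x * zpow (- k) x).
  congr cint; apply/funext => x; rewrite big_ord1 /pk conjcM zpow_conj chi_conj; ring.
have van (m : vfun R 1) : annih Psi m -> aeT (fun x => m ord0 x * chi x = 0).
  move=> [mH hm]; apply: fourier_unique; split.
    by apply: L1cM => //; exact: H2v_L2.
  by move=> k; rewrite -[RHS](hm (pk (- k))); [rewrite ipk opprK|exists (- k)].
have [w [wM wH w1]] : exists w : vfun R 1, [/\ annih Psi w, forall i, Hinf (w i) &
    aeT (fun x => \sum_i conjc (w i x) * w i x = 1)].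
  apply: nonzero_annih_col => //; exists (fun _ => u); split.
    split=> // _ [k ->]; rewrite ipk -(cint0 R); congr cint; apply/funext => x.
    rewrite /chi indicE; have [xZ|xZ] := boolP (x \in Z); last by rewrite mulr0 mul0r.
    move: xZ; rewrite inE => -[_] /= /cnorm2_eq0 ->; by rewrite !mul0r.
  by move=> h; apply: u0; apply: aeTS h => x /(_ ord0).
have := aeTS2 (fun _ a b => conj a b) (van _ wM) w1.
apply: (@filterS _ _ (ae_lebesgue_filter R)) => x k Tx ux0; have [] := k Tx.
rewrite big_ord1 /chi indicE mem_set; last by split=> //=; rewrite ux0 cnorm20.
by rewrite mulr1 => ->; rewrite mulr0 => /eqP; rewrite eq_sym oner_eq0.
Qed.

End QuotientField.

(** * The dimension count *)

Section Minors.
Variable R : realType.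
Local Notation C := R[i].

Definition extend_ord (T : Type) r (g : 'I_r -> T) (y : T) (b : 'I_r.+1) : T :=
  if unlift ord_max b is Some b' then g b' else y.
Lemma extend_ord_lift (T : Type) r (g : 'I_r -> T) y b : extend_ord g y (lift ord_max b) = g b.
Proof. by rewrite /extend_ord liftK. Qed.
Lemma extend_ord_max (T : Type) r (g : 'I_r -> T) y : extend_ord g y ord_max = y.
Proof. by rewrite /extend_ord unlift_none. Qed.

(** Rows and columns are selected by arbitrary maps; by [minor_inj] a nonzero value forces both to
    be injective. *)
Definition minor m k (A : mxfun R m k) r (rho : 'I_r -> 'I_m) (ga : 'I_r -> 'I_k) : cfun R :=
  fun x => \det (\matrix_(a, b) A (rho a) (ga b) x).

Lemma minor_inj m k (A : mxfun R m k) r (rho : 'I_r -> 'I_m) (ga : 'I_r -> 'I_k) x :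
  minor A rho ga x != 0 -> injective rho /\ injective ga.
Proof.
move=> h; split=> a b e; apply: contraNeq h => ab; apply/eqP.
  by apply: (determinant_alternate ab) => j; rewrite !mxE e.
rewrite /minor -det_tr; apply: (determinant_alternate ab) => j; by rewrite !mxE e.
Qed.

Lemma exists_nonzero (u : cfun R) : ~ aeT (fun x => u x = 0) -> exists x, u x != 0.
Proof.
move=> h; apply: contrapT => k; apply: h; apply: aeTW => x.
by apply/eqP; apply: contrapT => /negP ux; apply: k; exists x.
Qed.

(* A minor of maximal size, bordered by an extra column; the kernel vector consists of the
   cofactors of the bordering row. *)
Lemma max_minor m k (A : mxfun R m k) : (forall i j, Hinf (A i j)) ->
  exists r (rho : 'I_r -> 'I_m) (ga : 'I_r -> 'I_k),
    [/\ ~ aeT (fun x => minor A rho ga x = 0), injective rho, injective ga &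
      r = k \/ exists c : 'I_k -> cfun R, [/\ forall j, Hinf (c j),
        ~ aeT (fun x => forall j, c j x = 0) &
        aeT (fun x => forall i, \sum_j A i j x * c j x = 0)]].
Proof.
move=> hA.
pose P r := `[< exists (rho : 'I_r -> 'I_m) (ga : 'I_r -> 'I_k),
  ~ aeT (fun x => minor A rho ga x = 0) >].
have P0 : exists r, P r.
  exists 0%N; apply/asboolP.
  have f0 (T : Type) : 'I_0 -> T by case.
  exists (f0 _), (f0 _) => h; apply: (@aeT_false R); apply: aeTS h => x.
  by rewrite /minor det_mx00 => /eqP; rewrite oner_eq0.
have Pk r : P r -> (r <= k)%N.
  move=> /asboolP[rho [ga /exists_nonzero[x /minor_inj[_ gi]]]].
  by have := leq_card ga gi; rewrite !card_ord.
have [r /asboolP[rho [ga nz]] hmax] := ex_maxnP P0 Pk.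
have [x0 /minor_inj[rhoi gai]] := exists_nonzero nz.
exists r, rho, ga; split=> //.
have [->|rk] := eqVneq r k; [by left|right].
have [j0 hj0] : exists j0, j0 \notin codom ga.
  apply/existsP; rewrite -negb_forall; apply: contra rk => /forallP h.
  rewrite eqn_leq; have := leq_card ga gai; rewrite !card_ord => -> /=.
  suff : (#|'I_k| <= #|codom ga|)%N by rewrite card_codom// !card_ord.
  by apply: subset_leq_card; apply/fintype.subsetP => j _; exact: h.
pose ga' := extend_ord ga j0.
(* These cofactors do not involve the bordering row, so one vector [c] serves for all rows [i]. *)
pose cof (b : 'I_r.+1) : cfun R := fun x =>
  (-1) ^+ (@ord_max r + b) * \det (\matrix_(a, b') A (rho a) (ga' (lift b b')) x).
have cofH b : Hinf (cof b).
  by apply: HinfM; [exact: Hinf_cst|apply: (@Hinf_det R r (fun a b' => _))].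
pose c (j : 'I_k) : cfun R := fun x => \sum_(b | ga' b == j) cof b x.
exists c; split.
- by move=> j; apply: Hinf_sum.
(* Only [ord_max] is sent to [j0], so [c j0] is, up to sign, the maximal minor itself. *)
- move=> h; apply: nz; apply: aeTS h => x /(_ j0); rewrite /c (big_pred1 ord_max).
    rewrite /cof => /eqP; rewrite mulf_eq0 signr_eq0 /= => /eqP <-.
    by congr (\det _); apply/matrixP => a b; rewrite !mxE /ga' extend_ord_lift.
  move=> b /=; rewrite /ga' /extend_ord; case: unliftP => [b' ->|->].
    rewrite [RHS]eq_sym (negbTE (neq_lift _ _)); apply/negbTE; apply: contra hj0 => /eqP <-.
    exact: codom_f.
  by rewrite !eqxx.
apply: aeT_all => i; pose rho' := extend_ord rho i.
have van : aeT (fun x => minor A rho' ga' x = 0).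
  apply: contrapT => h; have /hmax : P r.+1 by apply/asboolP; exists rho', ga'.
  by rewrite ltnn.
apply: aeTS van => x; rewrite /minor (expand_det_row _ ord_max) => van.
rewrite -[RHS]van; transitivity (\sum_j \sum_(b | ga' b == j) A i (ga' b) x * cof b x).
  apply: eq_bigr => j _; rewrite mulr_sumr; apply: eq_bigr => b /eqP ->.
  by [].
rewrite [RHS](partition_big ga' xpredT)//=; apply: eq_bigr => j _; apply: eq_bigr => b _.
rewrite !mxE /rho' extend_ord_max; congr (_ * _); rewrite /cofactor /cof; congr (_ * \det _).
by apply/matrixP => a b'; rewrite !mxE extend_ord_lift.
Qed.

End Minors.

(** * Independence modulo the Nevanlinna class *)

Section Dimension.
Variable R : realType.
Local Notation C := R[i].

(** The common denominator is the product of the denominators. By [H2c_neq0] each factor vanishes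
    only on a null set, so the product is nonzero almost everywhere. *)
Lemma Nev_common (I : eqType) (r : seq I) (phi : I -> cfun R) :
  (forall i, i \in r -> Nev (phi i)) ->
  exists B : cfun R, [/\ Hinf B, aeT (fun x => B x <> 0) &
    forall i, i \in r -> exists a, Hinf a /\ aeT (fun x => phi i x * B x = a x)].
Proof.
elim: r => [_|i r ih h].
  exists (fun=> 1); split=> //; first exact: Hinf_cst.
  by apply: aeTW => x /eqP; rewrite oner_eq0.
have [|B [BH B0 hB]] := ih.
  by move=> j jr; apply: h; rewrite inE jr orbT.
have [a [b [aH bH b0 e]]] := h i (mem_head _ _).
exists (fun x => b x * B x); split; first exact: HinfM.
  apply: aeTS2 (H2c_neq0 (Hinf_H2 bH) b0) B0 => x bx Bx /eqP; rewrite mulf_eq0.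
  by move=> /orP[/eqP|/eqP].
move=> j; rewrite inE => /orP[/eqP ->|/hB[a' [aH' e']]].
  exists (fun x => a x * B x); split; first exact: HinfM.
  by apply: aeTS e => x <-; rewrite mulrA.
exists (fun x => b x * a' x); split; first exact: HinfM.
by apply: aeTS e' => x <-; ring.
Qed.

Variables (n s : nat) (f : 'I_s -> vfun R n).
Hypothesis fH : forall j, H2v (f j).

(** Uses z^(-l) f_j in place of the l-th backward shift of f_j. By [ip_iter_bshift] both have the
    same inner products with H^2, and this family is stable under multiplication by 1/z. *)
Definition shift_orbit (psi : vfun R n) := exists (l : nat) j, psi = smul (zpow (- l%:Z)) (f j).

Lemma shift_orbit_L2 psi : shift_orbit psi -> L2v psi.
Proof. by move=> [l [j ->]]; apply: L2v_zpow; exact: H2v_L2. Qed.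
Lemma shift_orbitS psi : shift_orbit psi -> shift_orbit (smul (zpow (-1)) psi).
Proof.
move=> [l [j ->]]; exists l.+1, j; rewrite smulD; congr (smul (zpow _) _).
by rewrite -[l.+1]add1n PoszD opprD.
Qed.

Lemma ip_shift_orbit (h : vfun R n) (l : nat) j : ip h (smul (zpow (- l%:Z)) (f j)) =
  cint (fun x => (\sum_i h i x * gbar f i j x) * zpow l x).
Proof.
congr cint; apply/funext => x; rewrite mulr_suml; apply: eq_bigr => i _.
by rewrite /smul /gbar conjcM zpow_conj opprK; ring.
Qed.

Variables (k : nat) (Th : mxfun R n k).
Hypothesis Thi : inner Th.
Hypothesis ThM : forall j, annih shift_orbit (mcol Th j).
Hypothesis complete : forall m, annih shift_orbit m ->
  (forall j (l : nat), ip m (smul (zpow l) (mcol Th j)) = 0) -> nullv m.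

Lemma inner_kernel (c : vfun R k) :
  aeT (fun x => forall i, mapply Th c i x = 0) -> aeT (fun x => forall j, c j x = 0).
Proof.
move=> h; apply: aeTS2 h Thi.2 => x h hx j.
by rewrite -(adj_apply_mapply c hx) /adj_apply big1// => i _; rewrite h mulr0.
Qed.

(** Theta is injective at almost every point, so the second alternative of [max_minor] fails and the
    maximal minor has size [k]. A relation supported off its rows becomes, once denominators are
    cleared, some h = Theta c vanishing on those rows; as the minor is invertible almost everywhere,
    c and h vanish. *)
Lemma indep_exists : exists I : {set 'I_n}, indepN (gbar f) I /\ (#|I| + k = n)%N.
Proof.
have [r [rho [ga [nz rhoi gai hr]]]] := max_minor (fun i j => Thi.1 i j).
have erk : r = k.
  case: hr => // -[c [_ c0 cA]]; case: c0; exact: inner_kernel.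
move: rho ga nz rhoi gai {hr}; rewrite erk => rho ga nz rhoi gai.
have mz : aeT (fun x => minor Th rho ga x <> 0).
  apply: H2c_neq0 nz; apply: Hinf_H2; apply: (@Hinf_det R k (fun a b => _)) => a b.
  exact: Thi.1.
pose J : {set 'I_n} := [set i in codom rho]%SET; exists (~: J); split; last first.
  have := cardsC J; rewrite card_ord {1}/J cardsE card_codom// card_ord => e.
  by rewrite addnC.
move=> a aN sN.
have [B1 [B1H B10 hB1]] := @Nev_common _ (enum (~: J)) a (fun i hi => aN i (eqbLR (mem_enum _ _) hi)).
have [B2 [B2H B20 hB2]] := @Nev_common _ (enum 'I_s) _ (fun j _ => sN j).
have /choice[a' ha'] : forall i, exists a', i \in ~: J -> Hinf a' /\ aeT (fun x => a i x * B1 x = a' x).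
  move=> i; have [iJ|iJ] := boolP (i \in ~: J); last by exists (fun=> 0).
  by have [|a' ?] := hB1 i; [rewrite mem_enum|exists a'].
(* [B1] clears the denominators of the [a i], and [B2] those of the combinations of the [gbar]. The
   factor z is needed because the annihilator also requires the coefficient of index 0 of F^* h to
   vanish. *)
pose h : vfun R n := fun i x => if i \in ~: J then zpow 1 x * (B2 x * a' i x) else 0.
have hH i : Hinf (h i).
  rewrite /h; case: (boolP (i \in ~: J)) => iJ; last exact: Hinf_cst.
  apply: HinfM; first exact: (Hinf_zpow R 1%N).
  by apply: HinfM => //; case: (ha' i iJ).
have hM : annih shift_orbit h.
  split=> [i|psi [l [j ->]]]; first exact: Hinf_H2.
  have [|c [cH ce]] := hB2 j; first by rewrite mem_enum.
  have BcH := Hinf_H2 (HinfM B1H cH).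
  rewrite ip_shift_orbit -[RHS](BcH.2 l); apply: cint_ae.
  - apply: cmeasM; last exact: zpow_meas.
    apply: cmeas_sum => i _; apply: cmeasM; first exact: Hinf_meas.
    by apply/cmeas_conj/L2c_meas/H2c_L2/fH.
  - by apply: cmeasM (zpow_meas _ _); exact: Hinf_meas (HinfM B1H cH).
  have ea : aeT (fun x => forall i, i \in ~: J -> a i x * B1 x = a' i x).
    apply: aeT_all => i; have [iJ|iJ] := boolP (i \in ~: J); last exact: aeTW.
    by apply: aeTS (ha' i iJ).2 => x ->.
  apply: aeTS2 ea ce => x ea ce.
  rewrite -[l.+1]add1n PoszD zpowD -ce mulr_suml mulr_suml (bigID (mem (~: J)))/=.
  rewrite [X in _ + X]big1 ?addr0 => [|i iJ]; last by rewrite /h (negbTE iJ) !mul0r.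
  rewrite mulr_sumr mulr_suml; apply: eq_bigr => i iJ.
  by rewrite /h iJ -(ea i iJ); ring.
have hr := annih_range shift_orbit_L2 shift_orbitS Thi ThM complete hM.
have h0 : aeT (fun x => forall i, h i x = 0).
  apply: aeTS2 hr mz => x hx mx.
  set c := adj_apply Th h in hx.
  pose N : 'M[C]_k := \matrix_(a, b) Th (rho a) (ga b) x.
  pose v : 'cV[C]_k := \col_b c (ga b) x.
  have Nv : N *m v = 0.
    apply/matrixP => p q; rewrite !mxE.
    transitivity (h (rho p) x); last first.
      by rewrite /h !inE codom_f.
    rewrite hx /mapply [RHS](reindex ga)/=; last exact/onW_bij/injF_bij.
    by apply: eq_bigr => b _; rewrite !mxE.
  have v0 : v = 0.
    have Nu : N \in unitmx by rewrite unitmxE unitfE; apply/eqP.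
    by rewrite -(mulKmx Nu v) Nv mulmx0.
  have c0 j : c j x = 0.
    have [g _ gK] := injF_bij gai.
    by have := congr1 (fun w : 'cV[C]_k => w (g j) 0) v0; rewrite !mxE gK.
  by move=> i; rewrite hx /mapply big1// => j _; rewrite c0 mulr0.
move=> i iJ; have [_ ei] := ha' i iJ.
have nzB := aeTS2 (fun _ p q => conj p q) B10 B20.
apply: aeTS2 (aeTS2 (fun _ p q => conj p q) h0 ei) nzB => x [/(_ i) hx ex] [B1x B2x].
move: hx; rewrite /h iJ -ex => /eqP.
have z0 : zpow 1 x != 0 :> C.
  by apply/eqP => z0; have := zpowNK 1 x; rewrite z0 mulr0 => /eqP; rewrite eq_sym oner_eq0.
rewrite !mulf_eq0 (negbTE z0) /=; move/eqP/negbTE: B1x => ->; move/eqP/negbTE: B2x => ->.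
by rewrite orbF => /eqP.
Qed.

(** If #|I| + k > n, the rows of Theta outside [I] are fewer than its columns, so [max_minor] yields
    a nonzero bounded analytic [c] in their kernel. Then h = Theta c is supported in [I], and F^* h
    is in H^2, hence in the Nevanlinna class. Independence forces h = 0, and then c = 0. *)
Lemma indep_bound (I : {set 'I_n}) : indepN (gbar f) I -> (#|I| + k <= n)%N.
Proof.
move=> hI; rewrite leqNgt; apply/negP => hlt.
have cI : (#|~: I| < k)%N.
  by have e := cardsC I; rewrite card_ord in e; lia.
pose A : mxfun R #|~: I| k := fun a j => Th (enum_val a) j.
have [r [rho [ga [_ rhoi _ [rk|[c [cH c0 cA]]]]]]] := max_minor (fun i j => Thi.1 (enum_val i) j : Hinf (A i j)).
  by have := leq_card rho rhoi; rewrite !card_ord rk leqNgt cI.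
pose h := mapply Th c.
have hH i : Hinf (h i) by apply: Hinf_sum => j _; apply: HinfM => //; exact: Thi.1.
have hout : aeT (fun x => forall i, i \notin I -> h i x = 0).
  apply: aeTS cA => x cA i iI.
  have iI' : i \in ~: I by rewrite inE.
  by have := cA (enum_rank_in iI' i); rewrite /A enum_rankK_in.
have sumE : aeT (fun x => forall j, \sum_(l < k) c l x * (\sum_i Th i l x * gbar f i j x) =
     \sum_(i in I) h i x * gbar f i j x).
  apply: aeTS hout => x hout j.
  transitivity (\sum_i h i x * gbar f i j x).
    under [RHS]eq_bigr do rewrite /h /mapply mulr_suml.
    rewrite [RHS]exchange_big; apply: eq_bigr => l _; rewrite mulr_sumr.
    by apply: eq_bigr => i _; ring.
  rewrite (bigID (mem I)) /= [X in _ + X]big1 ?addr0// => i iI.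
  by rewrite hout// mul0r.
have hz : forall i, i \in I -> aeT (fun x => h i x = 0).
  apply: hI => [i _|j]; first exact/H2c_Nev/Hinf_H2.
  apply: H2c_Nev; apply: H2c_ext (aeTS (fun x e => e j) sumE).
    apply: H2c_sum => l _; apply: HinfM_H2 => //.
    split.
      exact: (symbol_L2 Thi l (H2v_L2 (fH j))).
    (* [symbol_coef] covers all indices l >= 0, whereas H^2 asks only for l >= 1. *)
    move=> q; have := symbol_coef shift_orbitS ThM l q.+1 (psi := f j).
    apply; exists 0%N, j; by rewrite oppr0 smul0.
  apply: L2c_sum => i _; apply: HinfM_L2 => //.
  by apply: L2c_conj; apply: H2c_L2; exact: fH.
apply: c0; apply: inner_kernel; apply: aeT_all => i.
have [iI|iI] := boolP (i \in I); first exact: hz.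
by apply: aeTS hout => x /(_ i iI).
Qed.

(** Oriented so that rewriting turns the number of columns required by the theorem into the [k]
    supplied by [Beurling_Lax]. *)
Lemma indN_eq : (n - indN (gbar f) = k)%N.
Proof.
have [I [hI cI]] := indep_exists.
have -> : indN (gbar f) = #|I|; last by lia.
apply/eqP; rewrite eqn_leq; apply/andP; split.
  apply/bigmax_leqP => J /asboolP hJ; have := indep_bound hJ; lia.
by apply: (leq_bigmax_cond (F := fun J : {set 'I_n} => #|J|)); apply/asboolP.
Qed.

(** * The backward shift and the space spanned by its orbits *)

Lemma bshift_H2 (g : vfun R n) : H2v g -> H2v (bshift g).
Proof.
move=> gH i; have [gL g2] := gH i; have dL : L2c (fun x => g i x + - cint (g i)).
  by apply: L2cD => //; exact: L2c_cst.
split; first exact: L2c_zpowM.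
move=> [|q].
  rewrite (_ : (fun x => _) = fun x => g i x + - cint (g i)).
    by rewrite cintD ?cint_cst ?subrr//; apply: L2c_L1 => //; exact: L2c_cst.
  by apply/funext => x; rewrite /bshift mulrAC zpowNK mul1r.
rewrite (_ : (fun x => _) = fun x => g i x * zpow q.+1 x + (- cint (g i)) * zpow q.+1 x).
  rewrite cintD ?g2 ?add0r; [|exact: L1_coef|by apply: L1cZ; exact/L2c_L1/L2c_zpow].
  by rewrite cintZ ?cint_zpow ?mulr0//; exact/L2c_L1/L2c_zpow.
apply/funext => x; rewrite /bshift -[q.+2]add1n PoszD zpowD.
transitivity ((zpow (-1) x * zpow 1 x) * ((g i x - cint (g i)) * zpow q.+1 x)); first by ring.
by rewrite zpowNK mul1r; ring.
Qed.

(** The constant that the backward shift subtracts is orthogonal to z h, since h has no coefficient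
    of index -1. *)
Lemma ip_bshift (g h : vfun R n) : H2v g -> H2v h -> ip (bshift g) h = ip g (smul (zpow 1) h).
Proof.
move=> gH hH; have gL := H2v_L2 gH; have hL := H2v_L2 hH.
pose cg : vfun R n := fun i x => cint (g i).
have cgL : L2v cg by move=> i; exact: L2c_cst.
rewrite (_ : bshift g = smul (zpow (-1)) (lc (-1) g cg)); last first.
  by apply/funext => i; apply/funext => x; rewrite /bshift /smul /lc mulN1r.
rewrite ip_zpow opprK ip_lcl//; last exact: L2v_zpow.
rewrite (_ : ip cg _ = 0) ?mulr0 ?addr0//.
have LL i : L1c (fun x => conjc (h i x * zpow 1 x)) by apply: L1c_conj; exact: L1_coef.
rewrite /ip (_ : (fun x => _) = fun x => \sum_i cint (g i) * conjc (h i x * zpow 1 x)); last first.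
  by apply/funext => x; apply: eq_bigr => i _; rewrite /smul [_ * h i x]mulrC.
rewrite cint_sum => [|i _]; last exact: L1cZ.
rewrite big1// => i _; rewrite cintZ// cint_conj; last exact: L1_coef.
by have [_ /(_ 0%N) ->] := hH i; rewrite conjc0 mulr0.
Qed.

Lemma iter_bshift_H2 l (g : vfun R n) : H2v g -> H2v (iter l (@bshift R n) g).
Proof. by move=> gH; elim: l => //= l ih; exact: bshift_H2. Qed.

Lemma ip_iter_bshift l (g h : vfun R n) : H2v g -> H2v h ->
  ip (iter l (@bshift R n) g) h = ip g (smul (zpow l) h).
Proof.
move=> gH; elim: l h => [|l ih] h hH; first by rewrite smul0.
rewrite iterS ip_bshift//; last exact: iter_bshift_H2.
rewrite ih; last by move=> i; apply: HinfM_H2 => //; exact: (Hinf_zpow R 1%N).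
by rewrite smulD -PoszD addn1.
Qed.

Lemma comb_H2 N c : H2v (comb f N c).
Proof.
move=> i; apply: H2c_sum => l _; apply: H2c_sum => j _; apply: H2cZ.
exact: iter_bshift_H2.
Qed.

Lemma comb_lc t N c N' c' : exists M d, lc t (comb f N c) (comb f N' c') = comb f M d.
Proof.
exists (maxn N N'), (fun l j => (if (l < N)%N then c l j else 0) +
   t * (if (l < N')%N then c' l j else 0)).
have wid M (d : nat -> 'I_s -> C) i x : (M <= maxn N N')%N -> comb f M d i x =
    \sum_(l < maxn N N') \sum_j (if (l < M)%N then d l j else 0) * iter l (@bshift R n) (f j) i x.
  move=> le; rewrite /comb.
  rewrite (big_ord_widen _ (fun l => \sum_j d l j * iter l (@bshift R n) (f j) i x) le) big_mkcond.
  apply: eq_bigr => l _; case: ifP => // _.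
  by rewrite big1// => j _; rewrite mul0r.
apply/funext => i; apply/funext => x; rewrite /lc (wid N c i x (leq_maxl _ _)).
rewrite (wid N' c' i x (leq_maxr _ _)) /comb mulr_sumr -big_split; apply: eq_bigr => l _ /=.
rewrite mulr_sumr -big_split; apply: eq_bigr => j _ /=; ring.
Qed.

Lemma ip_comb0 N c (u : vfun R n) : annih shift_orbit u -> ip (comb f N c) u = 0.
Proof.
move=> [uH hu]; have uL := H2v_L2 uH.
have LL l j : L1c (fun x => \sum_i iter l (@bshift R n) (f j) i x * conjc (u i x)).
  by apply: ip_L1 => //; apply: H2v_L2; exact: iter_bshift_H2.
transitivity (cint (fun x => \sum_(l < N) \sum_j c l j *
    \sum_i iter l (@bshift R n) (f j) i x * conjc (u i x))).
  congr cint; apply/funext => x; under eq_bigr do rewrite /comb mulr_suml.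
  rewrite exchange_big; apply: eq_bigr => l _.
  under eq_bigr do rewrite mulr_suml.
  rewrite exchange_big; apply: eq_bigr => j _; rewrite mulr_sumr.
  by apply: eq_bigr => i _; rewrite mulrA.
rewrite cint_sum => [|l _]; last by apply: L1c_sum => j _; exact: L1cZ.
rewrite big1// => l _; rewrite cint_sum => [|j _]; last exact: L1cZ.
rewrite big1// => j _; rewrite cintZ//.
rewrite -[cint _]/(ip (iter l (@bshift R n) (f j)) u) ip_iter_bshift//.
rewrite (ip_conj (L2v_zpow l uL) (H2v_L2 (fH j))) ip_zpow hu ?conjc0 ?mulr0//.
by exists l, j.
Qed.

Let V (w : vfun R n) := exists N c, w = comb f N c.

(** Finite combinations of backward shifts are orthogonal to Theta H^2, which lies in the
    annihilator, and this passes to the closure. Conversely, let p be the projection of g onto that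
    closure. The difference g - p is in the annihilator, and it is orthogonal to all z^l Theta_j
    because both g and p are; completeness makes it null. *)
Lemma Estar_orthoCompl (g : vfun R n) : Estar f g <-> orthoCompl Th g.
Proof.
have VL w : V w -> L2v w by move=> [N [c ->]]; apply: H2v_L2; exact: comb_H2.
have Vort w (h : vfun R k) : H2v h -> V w -> ip w (mapply Th h) = 0.
  move=> hh [N [c ->]]; apply: ip_comb0.
  exact: (annih_mapply shift_orbit_L2 shift_orbitS Thi ThM).
have mL (h : vfun R k) : H2v h -> L2v (mapply Th h).
  by move=> hh; apply: mapply_L2 => //; exact: H2v_L2.
have subE w N c : (fun i x => w i x - comb f N c i x) = lc (-1) w (comb f N c).
  by apply/funext => i; apply/funext => x; rewrite /lc mulN1r.
split=> [[gH ge]|[gH go]]; split=> //; have gL := H2v_L2 gH.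
  move=> h hh; apply: (nearV_orth (V := V) (p := g) (h := mapply Th h)) => //; first exact: mL.
    by move=> w Vw; split; [exact: VL|exact: Vort].
  move=> eps e0; have [N [c hc]] := ge eps e0; exists (comb f N c); split; first by exists N, c.
  by move: hc; rewrite subE vnorm2E ?lte_fin//; apply: L2v_lc => //; apply: VL; exists N, c.
have [p [pL np hp]] : exists p, [/\ L2v p, nearV V p & forall w, V w -> ip (lc (-1) g p) w = 0].
  apply: projection => //.
  - by exists (comb f 0 (fun _ _ => 0)), 0%N, (fun _ _ => 0).
  - by move=> t _ _ [N [c ->]] [N' [c' ->]]; have [M [d e]] := comb_lc t N c N' c'; exists M, d.
have pH : H2v p.
  (* With no test vectors the annihilator is H^2 itself, and [annih_closed] says that H^2 is
     closed. *)
  pose E (_ : vfun R n) := False.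
  suff : annih E p by case.
  apply: annih_closed => // eps e0; have [w [[N [c ->]] hw]] := np eps e0.
  by exists (comb f N c); split=> //; split=> //; exact: comb_H2.
set r := lc (-1) g p in hp.
have rH : H2v r by exact: H2v_lc.
have rL := H2v_L2 rH.
have rM : annih shift_orbit r.
  split=> // _ [l [j ->]].
  have vL := H2v_L2 (iter_bshift_H2 l (fH j)).
  have : ip r (iter l (@bshift R n) (f j)) = 0.
    (* The coefficients single out the one term with indices [l] and [j]; length [l.+1] is the least
       that contains it. *)
    apply: hp; exists l.+1, (fun l' j' => ((l' == l) && (j' == j))%:R).
    apply/funext => i; apply/funext => x; rewrite /comb (bigD1 ord_max)//= (bigD1 j)//= !eqxx mul1r.
    rewrite big1 => [|j' /negbTE ->]; last by rewrite andbF mul0r.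
    rewrite big1 ?addr0// => l' ll'; rewrite big1// => j' _.
    suff /negbTE -> : (l' != l :> nat)%N by rewrite mul0r.
    by apply: contra ll' => /eqP e; apply/eqP/val_inj.
  rewrite (ip_conj vL rL) => /(congr1 conjc); rewrite conjcK conjc0.
  rewrite ip_iter_bshift// (ip_conj (L2v_zpow l rL) (H2v_L2 (fH j))) ip_zpow.
  by move=> /(congr1 conjc); rewrite conjcK conjc0.
have r0 : nullv r.
  apply: complete => // j l; rewrite smul_mcol.
  have dH := @delta_zpow_H2 R k l j.
  rewrite ip_lcl//; last exact: mL.
  rewrite [ip g _](go _ dH) add0r (_ : ip p _ = 0) ?mulr0//.
  apply: (nearV_orth (V := V)) => //; first exact: mL.
  by move=> w Vw; split; [exact: VL|exact: Vort].
move=> eps e0; have [w [[N [c ew]] hw]] := np eps e0; exists N, c.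
have wL : L2v (comb f N c) by apply: VL; exists N, c.
rewrite subE vnorm2E; last exact: L2v_lc.
rewrite lte_fin; move: hw; rewrite ew; congr (_ < _).
rewrite /nrm2; congr (complex.Re _).
have e : aeT (fun x => forall i, lc (-1) p (comb f N c) i x = lc (-1) g (comb f N c) i x).
  apply: aeTS r0 => x r0 i; move/eqP: (r0 i); rewrite /r /lc mulN1r subr_eq0 => /eqP ->.
  by [].
by apply: ip_ext => //; exact: L2v_lc.
Qed.

End Dimension.

Theorem mainTheorem4 (R : realType) (n s : nat) (f : 'I_s -> vfun R n) :
  (forall j, H2v (f j)) ->
  exists Th : mxfun R n (n - indN (gbar f)),
    inner Th /\ (forall g : vfun R n, Estar f g <-> orthoCompl Th g).
Proof.
move=> fH.
have [k [Th [Thi ThM comp]]] := Beurling_Lax (shift_orbit_L2 fH) (@shift_orbitS R n s f).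
rewrite (indN_eq fH Thi ThM comp); exists Th; split=> // g.
exact: Estar_orthoCompl.
Qed.
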